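(* Let $k,m\ge 1$ be integers and let $\lambda\in(0,1]$ be a real number. Let $\Sigma=(a_1,\ldots,a_n)$ be an $M$-bounded sequence in $\mathbb{Z}^k$ such that, for all distinct $A_1,A_2\in\mathcal{F}_{\lambda,n}$ of size at least $m$, $$e^m_{\Sigma}(A_1)\neq e^m_{\Sigma}(A_2).$$ Then $$M^{2m}\ \geq\ \begin{cases} \left(\dfrac{((m-1)!)^2\,\Gamma(k/2+1)^{2/k}}{2(\lambda^{2m-1}+\lambda^{2m})\,\pi(k+2)}\right)\dfrac{(1+o(1))\,|\mathcal{F}_{\lambda,n}|^{2/k}}{n^{2m-1}} & \text{if }\lambda<1/2,\\[3mm] \left(\dfrac{2^{2m}((m-1)!)^2\,\Gamma(k/2+1)^{2/k}}{(2^{2m+1}\lambda^{2m-1}+2^{2m+1}\lambda^{2m}+1)\,\pi(k+2)}\right)\dfrac{(1+o(1))\,|\mathcal{F}_{\lambda,n}|^{2/k}}{n^{2m-1}} & \text{if }\lambda=1/2,\\[3mm] \left(\dfrac{(m!)^2\,\Gamma(k/2+1)^{2/k}}{(2m^2\lambda^{2m-1}+2m^2\lambda^{2m}+1)\,\pi(k+2)}\right)\dfrac{(1+o(1))\,|\mathcal{F}_{\lambda,n}|^{2/k}}{n^{2m-1}} & \text{if }\lambda>1/2. \end{cases}$$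
   Context: Here $[1,n]=\{1,\ldots,n\}$, and $\mathcal{F}_{\lambda,n}$ is the family of all subsets of $[1,n]$ of size at most $\lambda n$. A sequence $\Sigma=(a_1,\ldots,a_n)$ in $\mathbb{Z}^k$ is $M$-bounded if $a_i\in[0,M]^k$ for every $i$. For $A\subseteq[1,n]$, $$e^m_{\Sigma}(A)=\sum_{\{i_1<\cdots<i_m\}\subseteq A}a_{i_1}\cdots a_{i_m}\in\mathbb{Z}^k,$$ where products of vectors are taken coordinatewise (so each coordinate of $e^m_\Sigma(A)$ is the $m$-th elementary symmetric polynomial evaluated at the corresponding coordinates of the $a_i$, $i\in A$), with the convention $e^m_\Sigma(A)=0$ if $|A|<m$. $\Gamma$ is the Gamma function. $o(1)$ denotes a quantity tending to $0$ as $n\to\infty$ with $k,m,\lambda$ fixed, uniformly in $\Sigma$ and $M$. *)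

(* Defs.v *)
From HB Require Import structures.
From mathcomp Require Import all_boot all_order all_algebra.
From mathcomp Require Import all_classical all_reals all_analysis.
Set Implicit Arguments.
Unset Strict Implicit.
Unset Printing Implicit Defensive.
Import Order.TTheory GRing.Theory Num.Theory.
Import numFieldNormedType.Exports.
Local Open Scope ring_scope.
Local Open Scope classical_set_scope.

(* 'I_n stands for [1,n], and {ffun 'I_k -> int} for Z^k with its pointwise
   ring structure, so that the products in elem_sym are coordinatewise. *)

Definition small_sets (R : realType) (lambda : R) (n : nat) : {set {set 'I_n}} :=
  [set A : {set 'I_n} | (#|A|%:R <= lambda * n%:R)]%SET.

Definition bounded_seq (R : realType) (M : R) (n k : nat)
    (a : 'I_n -> {ffun 'I_k -> int}) : Prop :=
  forall (i : 'I_n) (j : 'I_k), (0 : R) <= (a i j)%:~R <= M.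

Definition elem_sym (n k m : nat) (a : 'I_n -> {ffun 'I_k -> int})
    (A : {set 'I_n}) : {ffun 'I_k -> int} :=
  \sum_(B : {set 'I_n} | (B \subset A) && (#|B| == m)) \prod_(i in B) a i.

Lemma elem_sym_coord (n k m : nat) (a : 'I_n -> {ffun 'I_k -> int})
    (A : {set 'I_n}) (j : 'I_k) :
  elem_sym m a A j =
  \sum_(B : {set 'I_n} | (B \subset A) && (#|B| == m)) \prod_(i in B) a i j.
Proof.
rewrite /elem_sym sum_ffunE; apply: eq_bigr => B _.
by elim/big_rec2: _ => [|i y1 y2 _ <-]; rewrite ffunE.
Qed.

Lemma elem_sym_small (n k m : nat) (a : 'I_n -> {ffun 'I_k -> int})
    (A : {set 'I_n}) : (#|A| < m)%N -> elem_sym m a A = 0.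
Proof.
move=> Am; rewrite /elem_sym big_pred0// => B; apply/negP => /andP[BA /eqP Bm].
by move: (subset_leq_card BA); rewrite Bm leqNgt Am.
Qed.

(* Meant for x > 0, where the integral converges. *)
Definition Gamma (R : realType) (x : R) : R :=
  \int[@lebesgue_measure R]_(t in `]0%R, +oo[) (t `^ (x - 1) * expR (- t)).

Definition bound_const (R : realType) (k m : nat) (lambda : R) : R :=
  let G := Gamma (k%:R / 2 + 1) `^ (2 / k%:R) in
  let P := pi * (k%:R + 2) in
  if lambda < 1 / 2 then
    (m.-1`!%:R ^+ 2 * G) /
    (2 * (lambda ^+ (2 * m - 1) + lambda ^+ (2 * m)) * P)
  else if lambda == 1 / 2 then
    (2 ^+ (2 * m) * m.-1`!%:R ^+ 2 * G) /
    ((2 ^+ (2 * m + 1) * lambda ^+ (2 * m - 1)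
      + 2 ^+ (2 * m + 1) * lambda ^+ (2 * m) + 1) * P)
  else
    (m`!%:R ^+ 2 * G) /
    ((2 * m%:R ^+ 2 * lambda ^+ (2 * m - 1)
      + 2 * m%:R ^+ 2 * lambda ^+ (2 * m) + 1) * P).

(* Main.v *)
Require Import Defs.
From mathcomp Require Import all_boot all_order all_algebra.
From mathcomp Require Import all_classical all_reals all_analysis measurable_realfun.
From mathcomp Require Import ring lra zify.
Set Implicit Arguments.
Unset Strict Implicit.
Unset Printing Implicit Defensive.
Import Order.TTheory GRing.Theory Num.Theory.
Import numFieldNormedType.Exports.
Local Open Scope ring_scope.
Local Open Scope classical_set_scope.

(** A family [G] of sets on which [elem_sym m a] takes distinct values in Z^k and
    has second moment at most [v] per coordinate satisfies
    [#|G| <= e^(k/2) (1 + sqrt (2 pi v))^k]: sum a Gaussian weight over the values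
    and compare with the whole lattice.  On a narrow window of sizes just below
    [lambda n] (or on the whole cube when [lambda >= 1/2]), which carries 99% of
    [small_sets], the second moment is governed by the pairs of [m]-sets meeting
    in exactly one point, so that [v] is at most about
    [lambda^(2m-1) M^(2m) n^(2m-1) / ((m-1)!)^2].  This is smaller by a factor at
    least 2 than what the claimed constant allows, and the loss in
    [Gamma (k/2+1)^(2/k) <= 0.95 (k+2) / e] does not exhaust that factor; hence
    the bound holds without any error term for [n] large, and [o] is [-1] (which
    makes the bound trivial) for the finitely many other [n]. *)

(** * Upper bounds for the Gamma function *)

Lemma integral_exp_decay (R : realType) (r : R) : 0 < r ->
  (\int[@lebesgue_measure R]_(t in `]0%R, +oo[) (expR (- (r * t)))%:E = (r^-1)%:E)%E.
Proof.
move=> r0; rewrite integral_itv_obnd_cbnd; last first.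
  apply/measurable_EFinP; apply: measurableT_comp => //.
  by apply: measurable_funTS; apply: measurableT_comp => //; exact: mulrl_measurable.
have : (\int[@lebesgue_measure R]_(t in `[0%R, +oo[)
    (r%:E * (expR (- (r * t)))%:E) = 1)%E.
  rewrite -(integral_exponential_pdf r0) integral_mkcond.
  apply: eq_integral => t _; rewrite /exponential_pdf !patchE.
  by case: ifP => // _; rewrite -EFinM mulNr.
rewrite ge0_integralZl_EFin//=; last 2 first.
- apply/measurable_EFinP; apply: measurableT_comp => //.
  by apply: measurable_funTS; apply: measurableT_comp => //; exact: mulrl_measurable.
- exact: ltW.
move=> e; have := congr1 (mule (r^-1)%:E) e.
by rewrite mule1 muleA -EFinM mulVf ?mul1e ?gt_eqF.
Qed.

(* Integrating the hypothesis against [exp (- t)]. *)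
Lemma Rintegral_exp_weight_le (R : realType) (f : R -> R) (b d c : R) :
  measurable_fun setT f -> (forall t, 0 < t -> 0 <= f t) ->
  0 < b -> 0 <= d -> c < 1 ->
  (forall t, 0 < t -> b * f t + d <= expR (c * t)) ->
  b * \int[@lebesgue_measure R]_(t in `]0%R, +oo[) (f t * expR (- t)) + d
    <= (1 - c)^-1.
Proof.
move=> mf f0 b0 d0 c1 fle; set D := `]0, +oo[.
have mD : measurable D by exact: measurable_itv.
have Dpos t : D t -> 0 < t by rewrite /D /= in_itv/= andbT.
have mw : measurable_fun D (fun t : R => expR (- t)).
  by apply: measurable_funTS; apply: measurableT_comp.
have mfw : measurable_fun D (fun t : R => f t * expR (- t)).
  by apply: measurable_funM => //; exact: measurable_funTS.
have I0 : (0 <= \int[@lebesgue_measure R]_(t in D) (f t * expR (- t))%:E)%E.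
  by apply: integral_ge0 => t /Dpos/f0 ft; rewrite lee_fin mulr_ge0 ?expR_ge0.
have Iw : (\int[@lebesgue_measure R]_(t in D) (expR (- t))%:E = 1)%E.
  rewrite -[RHS](_ : (1^-1)%:E = 1%E :> \bar R); last by rewrite invr1.
  rewrite -(integral_exp_decay (@ltr01 R)).
  by apply: eq_integral => t _; rewrite mul1r.
have key : (b%:E * \int[@lebesgue_measure R]_(t in D) (f t * expR (- t))%:E + d%:E
            <= ((1 - c)^-1)%:E)%E.
  rewrite -(@integral_exp_decay _ (1 - c)) ?subr_gt0//.
  rewrite -[X in (_ + X <= _)%E]mule1 -Iw -!ge0_integralZl_EFin//; last 4 first.
  - exact/measurable_EFinP.
  - by move=> t /Dpos/f0 ft; rewrite lee_fin mulr_ge0 ?expR_ge0.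
  - exact/measurable_EFinP.
  - exact: ltW.
  rewrite -ge0_integralD//; last 4 first.
  - by move=> t /Dpos/f0 ft; rewrite -EFinM lee_fin !mulr_ge0 ?expR_ge0// ltW.
  - by apply/measurable_EFinP; exact: measurable_funM.
  - by move=> t _; rewrite -EFinM lee_fin mulr_ge0 ?expR_ge0.
  - by apply/measurable_EFinP; exact: measurable_funM.
  apply: ge0_le_integral => //.
  - move=> t /Dpos/f0 ft; rewrite -!EFinM -EFinD lee_fin addr_ge0 ?mulr_ge0 ?expR_ge0//.
    exact: ltW.
  - apply: emeasurable_funD; apply/measurable_EFinP; exact: measurable_funM.
  - apply/measurable_EFinP; apply: measurable_funTS; apply: measurableT_comp => //.
    by apply: measurableT_comp => //; exact: mulrl_measurable.
  move=> t /Dpos t0; rewrite -!EFinM -EFinD lee_fin mulrA -mulrDl.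
  rewrite (_ : - ((1 - c) * t) = c * t - t); last by ring.
  by rewrite expRD ler_wpM2r ?expR_ge0// fle.
rewrite /Rintegral -lee_fin EFinD EFinM fineK//.
(* The passage from extended to real integrals needs a finite value; [key] itself provides it, after
   dividing by [b]. *)
rewrite ge0_fin_numE//; apply: (@le_lt_trans _ _ ((b^-1 * (1 - c)^-1)%:E)) => //; last by rewrite ltry.
rewrite -[leLHS](mul1e) -[X in (X%:E * _)%E](mulVf (lt0r_neq0 b0)) !EFinM -muleA.
rewrite lee_pmul2l// ?lte_fin ?invr_gt0//.
by apply: le_trans key; rewrite leeDl ?lee_fin.
Qed.

(** From [1 + x <= exp x] at [x = -1/16], raised to the 16th power: [(15/16)^16 <= 1/e]. The case
    [k = 1] of [Gamma_root_le] leaves little room above this value. *)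
Lemma expR1_lt (R : realType) : expR 1 < 281 / 100 :> R.
Proof.
have h : (1 - (1/16) : R) <= expR (- (1/16)) by apply: expR_ge1Dx.
have h2 : (1 - (1/16) : R) ^+ 16 <= (expR (- (1/16))) ^+ 16.
  by apply: lerXn2r => //; rewrite ?nnegrE ?expR_ge0//; lra.
have e : (expR (- (1/16)) : R) ^+ 16 = (expR 1)^-1.
  by rewrite -expRM_natl -expRN; congr expR; lra.
rewrite e in h2.
have b : (281 / 100 : R)^-1 < (1 - 1/16) ^+ 16 by lra.
by have := lt_le_trans b h2; rewrite ltf_pV2 ?posrE ?expR_gt0//; lra.
Qed.

(** By [2 sqrt t <= 1 + t], one has [(2 sqrt t)/100 + 99/100 <= 1 + t/100 <= exp (t/100)]; this is
    integrated against [exp (- t)]. *)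
Lemma Gamma_three_halves_le (R : realType) : Gamma (1 / 2 + 1 : R) <= 199 / 198.
Proof.
have H := @Rintegral_exp_weight_le R (fun t => t `^ (1/2)) (2 * (1/100)) (1 - 1/100) (1/100)
  (measurable_powR _) (fun t _ => powR_ge0 _ _).
rewrite /Gamma addrK.
suff : 2 * (1 / 100) *
    \int[lebesgue_measure]_(t in `]0%R, +oo[) (t `^ (1 / 2) * expR (- t)) +
    (1 - 1 / 100) <= (1 - 1 / 100)^-1 :> R.
  by rewrite (_ : (1 - 1 / 100)^-1 = 100 / 99 :> R); [lra|field].
apply: H => [| | |t t0]; [lra|lra|lra|].
apply: le_trans (expR_ge1Dx _).
have s2 : (t `^ (1/2)) ^+ 2 = t.
  by rewrite -powR_mulrn ?powR_ge0// -powRrM (_ : 1/2 * 2%:R = 1) ?powRr1 ?(ltW t0)//; lra.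
by have := sqr_ge0 (1 - t `^ (1/2)); nra.
Qed.

(** Here [t/100 + 1 <= exp (t/100)] is integrated against [exp (- t)]. The small slope makes the
    loss only about one percent. *)
Lemma Gamma_two_le (R : realType) : Gamma (2 / 2 + 1 : R) <= 100 / 99.
Proof.
have H := @Rintegral_exp_weight_le R (fun t => t `^ (2/2)) (1/100) 1 (1/100)
  (measurable_powR _) (fun t _ => powR_ge0 _ _).
rewrite /Gamma addrK.
suff : (1 / 100) *
    \int[lebesgue_measure]_(t in `]0%R, +oo[) (t `^ (2 / 2) * expR (- t)) +
    1 <= (1 - 1 / 100)^-1 :> R.
  by rewrite (_ : (1 - 1 / 100)^-1 = 100 / 99 :> R); [lra|field].
apply: H => [| | |t t0]; [lra|lra|lra|].
apply: le_trans (expR_ge1Dx _).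
by rewrite divff// powRr1 ?(ltW t0)//; lra.
Qed.

(* [t^a exp (- a t / (a + 1))] is maximal at [t = a + 1]. *)
Lemma Gamma_le (R : realType) (a : R) : 0 < a ->
  Gamma (a + 1) <= (a + 1) * ((a + 1) / expR 1) `^ a.
Proof.
move=> a0.
have a1 : 0 < a + 1 by lra.
have a1' : a + 1 != 0 by rewrite gt_eqF.
set B := (_ / _) `^ a.
have B0 : 0 < B by rewrite powR_gt0 ?divr_gt0 ?expR_gt0.
have H := @Rintegral_exp_weight_le R (fun t => t `^ a) B^-1 0 (a / (a + 1))
  (measurable_powR _) (fun t _ => powR_ge0 _ _).
have c1 : 1 - a / (a + 1) = (a + 1)^-1 by field.
rewrite /Gamma addrK -ler_pdivrMr// [leLHS]mulrC -[leLHS]addr0.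
rewrite -[leRHS](invrK) -c1; apply: H => //.
- by rewrite invr_gt0.
- by rewrite -subr_gt0 c1 invr_gt0.
move=> t t0; rewrite addr0 mulrC ler_pdivrMr//.
rewrite (_ : a / (a + 1) * t = t / (a + 1) * a); last by field.
rewrite expRM /B -powRM ?expR_ge0 ?divr_ge0 ?(ltW a1)//.
apply: ge0_ler_powR; rewrite ?(ltW a0) ?nnegrE ?(ltW t0) ?mulr_ge0 ?expR_ge0 ?invr_ge0 ?expR_ge0 ?(ltW a1)//.
(* With [u = t / (a + 1)] this is [u <= exp (u - 1)], an equality at the maximum [u = 1]. *)
have := expR_ge1Dx (t / (a + 1) - 1); rewrite expRB addrC subrK ler_pdivrMr//.
by move/le_trans; apply; rewrite le_eqVlt; apply/orP; left; apply/eqP; ring.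
Qed.

(** Absorbs the stray factor [a + 1] of [Gamma_le], where [a = k/2], into [(19/10)^a]. It fails for
    [k = 1] and [k = 2], whence the two separate Gamma values above. *)
Lemma sqr_half_succ_le (R : realType) (k : nat) : (3 <= k)%N ->
  (k%:R / 2 + 1 : R) ^+ 2 <= (19 / 10) ^+ k.
Proof.
elim: k => // k IH; rewrite leq_eqVlt => /orP[/eqP <-|]; first by lra.
rewrite ltnS => k3; have := IH k3; rewrite [_ ^+ k.+1]exprS -[k.+1%:R]natr1.
have : (3 : R) <= k%:R by rewrite (ler_nat _ 3).
set x : R := k%:R; set y : R := _ ^+ k; move=> x3 xy.
by have x2 : 3 * x <= x * x by [rewrite ler_wpM2r//; lra]; lra.
Qed.

(** The right side is [0.95 (k + 2) / e], so the factor [k + 2] in the denominator of [bound_const]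
    cancels and leaves a constant independent of [k]. *)
Lemma Gamma_root_le (R : realType) (k : nat) : (1 <= k)%N ->
  Gamma (k%:R / 2 + 1) `^ (2 / k%:R) <= 19 / 10 * (k%:R / 2 + 1) / expR 1 :> R.
Proof.
have G0 (x : R) : 0 <= Gamma x.
  by apply: Rintegral_ge0 => t _; rewrite mulr_ge0 ?powR_ge0 ?expR_ge0.
have e0 : (0 : R) < expR 1 := expR_gt0 1.
have e1 := @expR1_lt R.
case: k => [|[|[|k]]] // _.
- rewrite divr1 powR_mulrn// ler_pdivlMr//.
  have G1 := @Gamma_three_halves_le R; move: (G0 (1/2 + 1)) G1.
  set g := Gamma _ => g0 g1.
  have : g ^+ 2 <= (199 / 198) ^+ 2 by apply: lerXn2r; rewrite ?nnegrE//; lra.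
  by set h := g ^+ 2 => hh; have := sqr_ge0 g; rewrite -/h => h0; nra.
- rewrite [X in _ `^ X](_ : _ = 1); last by rewrite divff.
  rewrite powRr1// ler_pdivlMr//.
  have G1 := @Gamma_two_le R; move: (G0 (2/2 + 1)) G1.
  by set g := Gamma _ => g0 g1; nra.
set K : R := k.+3%:R; set a := K / 2.
have K0 : 0 < K by rewrite ltr0n.
have a0 : 0 < a by rewrite divr_gt0.
have a1 : 0 < a + 1 by lra.
set B := 19 / 10 * (a + 1) / expR 1.
have B0 : 0 < B by rewrite !(mulr_gt0, divr_gt0).
rewrite -[leRHS](_ : (B `^ a) `^ (2 / K) = B); last first.
  rewrite -powRrM (_ : a * (2 / K) = 1) ?powRr1 ?(ltW B0)//.
  by rewrite /a; field; rewrite gt_eqF.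
apply: ge0_ler_powR; rewrite ?nnegrE ?powR_ge0 ?divr_ge0 ?(ltW K0)//.
apply: le_trans (Gamma_le a0) _.
rewrite /B -[19 / 10 * _ / _]mulrA [(19 / 10 * _) `^ _]powRM ?divr_ge0 ?(ltW a1) ?(ltW e0)//.
rewrite ler_wpM2r ?powR_ge0//.
rewrite -(@ler_pXn2r _ 2)// ?nnegrE ?powR_ge0 ?(ltW a1)//.
rewrite -[(_ `^ a) ^+ 2]powR_mulrn ?powR_ge0// -powRrM (_ : a * 2%:R = K); last by rewrite /a; field.
rewrite /K powR_mulrn; first exact: sqr_half_succ_le.
lra.
Qed.

(** * Gaussian sums and counting of lattice points *)

Lemma sum_normal_prob_le1 (R : realType) (c s : R) (K : nat) :
  \sum_(x < K) fine (normal_prob c s `[x%:R, x.+1%:R[%classic) <= 1.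
Proof.
have mI (x y : R) : measurable `[x, y[%classic by exact: measurable_itv.
suff -> : \sum_(x < K) fine (normal_prob c s `[x%:R, x.+1%:R[%classic) =
    fine (normal_prob c s `[0%R, K%:R[%classic).
  by rewrite -lee_fin fineK ?fin_num_measure// probability_le1.
elim: K => [|K IH].
  by rewrite big_ord0 set_itvco0 measure0.
rewrite big_ord_recr/= IH -fineD ?fin_num_measure// -measureU//.
  by rewrite -itv_bndbnd_setU// bnd_simp ?ler0n ?ler_nat.
apply/seteqP; split => // t [] /=; rewrite !in_itv/= => /andP[_ tK] /andP[+ _].
by rewrite leNgt tK.
Qed.

(** The bump increases up to [c] and decreases afterwards, so its minimum over an interval is at an
    endpoint. *)
Lemma normal_fun_ge_min (R : realType) (c s x t : R) : x <= t <= x + 1 ->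
  Num.min (normal_fun c s x) (normal_fun c s (x + 1)) <= normal_fun c s t.
Proof.
move=> /andP[xt tx]; rewrite /normal_fun ge_min !ler_expR.
have i0 : 0 <= (s ^+ 2 *+ 2)^-1 by rewrite invr_ge0 mulrn_wge0 ?sqr_ge0.
apply/orP; have [tc|tc] := leP t c; [left|right]; rewrite ler_wpM2r// lerN2; nra.
Qed.

Lemma normal_prob_itv_ge (R : realType) (c s x : R) : s != 0 ->
  normal_peak s * Num.min (normal_fun c s x) (normal_fun c s (x + 1)) <=
    fine (normal_prob c s `[x, x + 1[%classic).
Proof.
move=> s0; set z := _ * _.
have mI : measurable `[x, x + 1[%classic by exact: measurable_itv.
rewrite -lee_fin fineK ?fin_num_measure//.
have -> : z%:E = (z%:E * @lebesgue_measure R `[x, (x + 1)%R[%classic)%E.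
  by rewrite lebesgue_measure_itv/= lte_fin ltrDl ltr01 -EFinD addrAC subrr add0r mule1.
rewrite -integral_cst//; apply: ge0_le_integral => //.
- move=> t _; rewrite lee_fin mulr_ge0 ?normal_peak_ge0// le_min !normal_fun_ge0//.
- apply/measurable_EFinP; apply: measurable_funTS; exact: measurable_normal_pdf.
move=> t /=; rewrite in_itv/= => /andP[xt tx].
rewrite lee_fin normal_pdfE// ler_wpM2l ?normal_peak_ge0// normal_fun_ge_min// xt ltW//.
Qed.

(* An increasing stretch of the sum is compared with the integral to the right
   of each point; where the bump decreases the sum loses at most the total
   decrease, recorded by [T]. *)
Lemma sum_normal_fun_le (R : realType) (c s : R) (K : nat) : s != 0 ->
  \sum_(x < K) normal_fun c s x%:R <= (normal_peak s)^-1 + 1.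
Proof.
move=> s0; pose h := normal_fun c s; pose T x := if x <= c then 1 else h x.
have hl1 x : h x <= 1.
  rewrite /h /normal_fun -expR0 ler_expR mulNr oppr_le0 mulr_ge0 ?sqr_ge0//.
  by rewrite invr_ge0 mulrn_wge0 ?sqr_ge0.
have h0 x : 0 <= h x by exact: normal_fun_ge0.
have p0 := normal_peak_gt0 s0.
have step x : h x <= (normal_peak s)^-1 * fine (normal_prob c s `[x, x + 1[%classic)
    + (T x - T (x + 1)).
  have : Num.min (h x) (h (x + 1)) <=
      (normal_peak s)^-1 * fine (normal_prob c s `[x, x + 1[%classic).
    by rewrite ler_pdivlMl// normal_prob_itv_ge.
  set q := _ * fine _ => mq; rewrite /T.
  have dec y : c < y -> h (y + 1) <= h y.
    move=> cy; rewrite /h /normal_fun ler_expR ler_wpM2r ?invr_ge0 ?mulrn_wge0 ?sqr_ge0//.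
    by rewrite lerN2; nra.
  have inc : x + 1 <= c -> h x <= h (x + 1).
    move=> cy; rewrite /h /normal_fun ler_expR ler_wpM2r ?invr_ge0 ?mulrn_wge0 ?sqr_ge0//.
    by rewrite lerN2; nra.
  (* When [x <= c < x + 1], the drop of [T] is [1 - h (x + 1)]; this suffices whichever endpoint
     attains the minimum, since [h <= 1]. *)
  move: mq; rewrite ge_min; case: (leP x c) => xc; case: (leP (x + 1) c) => xc1.
  - by have := inc xc1; move=> hh /orP[]; lra.
  - by have := hl1 (x + 1); have := hl1 x; move=> ? ? /orP[]; lra.
  - by lra.
  - by have := dec _ xc; move=> ? /orP[]; lra.
have le1 := sum_normal_prob_le1 c s K.
apply: (@le_trans _ _ (\sum_(x < K) ((normal_peak s)^-1 *
    fine (normal_prob c s `[x%:R, x.+1%:R[%classic) + (T x%:R - T x.+1%:R)))).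
  by apply: ler_sum => x _; have := step x%:R; rewrite -natr1.
rewrite big_split/= -mulr_sumr.
have -> : \sum_(x < K) (T x%:R - T x.+1%:R) = T 0 - T K%:R.
  elim: K {le1} => [|K IH]; first by rewrite big_ord0 subrr.
  by rewrite big_ord_recr/= IH addrA subrK.
apply: lerD.
  by rewrite ler_piMr// invr_ge0 ltW.
have T0 x : 0 <= T x by rewrite /T; case: ifP.
have T1 x : T x <= 1 by rewrite /T; case: ifP.
by have := T0 K%:R; have := T1 0; lra.
Qed.

Lemma gauss_sum_le (R : realType) (c v : R) (K : nat) : 0 < v ->
  \sum_(x < K) expR (- (x%:R - c) ^+ 2 / (2 * v)) <= Num.sqrt (2 * pi * v) + 1.
Proof.
move=> v0; have s0 : Num.sqrt v != 0 by rewrite gt_eqF// sqrtr_gt0.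
have := sum_normal_fun_le c K s0; rewrite /normal_peak invrK.
have -> : 2 * pi * v = Num.sqrt v ^+ 2 * pi *+ 2.
  by rewrite sqr_sqrtr ?(ltW v0)// -mulr_natl; ring.
by under eq_bigr do rewrite /normal_fun sqr_sqrtr ?(ltW v0)// -[v *+ 2]mulr_natl.
Qed.

(* Gaussian weights: by [exp z >= 1 + z], the sum over [G] of the density
   centred at [c] is at least [|G| exp (- k / 2)]; since the points are distinct
   it is at most the full lattice sum, which factors over the coordinates. *)
Lemma card_le_of_second_moment (R : realType) (T : finType) (G : {set T}) (k : nat)
    (f : T -> {ffun 'I_k -> int}) (c : 'I_k -> R) (v : R) : 0 < v ->
  {in G &, injective f} -> (forall A j, A \in G -> 0 <= f A j) ->
  (forall j, \sum_(A in G) ((f A j)%:~R - c j) ^+ 2 <= #|G|%:R * v) ->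
  #|G|%:R <= expR (k%:R / 2) * (Num.sqrt (2 * pi * v) + 1) ^+ k.
Proof.
move=> v0 finj f0 fv.
(* All values lie in the box [[0, K]^k], so the lattice sum can be taken as a finite sum over
   functions into ['I_K.+1]. *)
pose K := \max_(A : T) \max_(j : 'I_k) `|f A j|%N.
have fK A j : (`|f A j| < K.+1)%N.
  rewrite ltnS; apply: leq_trans (leq_bigmax (F := fun A => \max_(j : 'I_k) `|f A j|%N) A).
  exact: (leq_bigmax (F := fun j => `|f A j|%N)).
pose g A : {ffun 'I_k -> 'I_K.+1} := [ffun j => inord `|f A j|%N].
have gE A j : A \in G -> (g A j : nat)%:R = (f A j)%:~R :> R.
  by move=> AG; rewrite ffunE inordK ?fK// natr_absz ger0_norm ?f0.
have ginj : {in G &, injective g}.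
  move=> A B AG BG gAB; apply: finj => //; apply/ffunP => j.
  by apply: (@intr_inj R); rewrite -!gE// gAB.
pose w j (x : 'I_K.+1) : R := expR (- (x%:R - c j) ^+ 2 / (2 * v)).
have upper : \sum_(A in G) \prod_j w j (g A j) <= (Num.sqrt (2 * pi * v) + 1) ^+ k.
  rewrite -(big_imset (fun y : {ffun 'I_k -> 'I_K.+1} => \prod_j w j (y j)) ginj)/=.
  apply: (@le_trans _ _ (\sum_(y : {ffun 'I_k -> 'I_K.+1}) \prod_j w j (y j))).
    rewrite [leRHS](bigID (mem (g @: G)))/= lerDl sumr_ge0// => y _.
    by apply: prodr_ge0 => j _; exact: expR_ge0.
  rewrite -bigA_distr_bigA/= -[in leRHS](card_ord k) -prodr_const.
  apply: ler_prod => j _; rewrite gauss_sum_le// andbT.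
  by apply: sumr_ge0 => x _; exact: expR_ge0.
apply: le_trans (ler_wpM2l (expR_ge0 _) upper).
rewrite mulr_sumr.
(* Multiplying by [exp (k/2)] adds [1/2] to the exponent for each coordinate. After
   [exp z >= 1 + z], the terms of each coordinate sum over [G] to something nonnegative, by the
   moment hypothesis. *)
apply: (@le_trans _ _ (\sum_(A in G) (1 + \sum_(j < k)
    (1 / 2 - ((f A j)%:~R - c j) ^+ 2 / (2 * v))))); last first.
  apply: ler_sum => A AG; apply: le_trans (expR_ge1Dx _) _.
  rewrite big_split/= sumr_const card_ord expRD expR_sum.
  rewrite -[_ *+ k]mulr_natl mulrA mulr1 ler_wpM2l ?expR_ge0// le_eqVlt; apply/orP; left; apply/eqP.
  by apply: eq_bigr => j _; rewrite /w gE// mulNr.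
rewrite big_split/= sumr_const exchange_big/=.
rewrite -[leLHS]addr0 lerD2l; apply: sumr_ge0 => j _.
rewrite sumrB sumr_const -mulr_suml -[_ *+ _]mulr_natl.
rewrite subr_ge0 ler_pdivrMr ?mulr_gt0//.
suff -> : #|G|%:R * (1 / 2) * (2 * v) = #|G|%:R * v by exact: fv.
by field.
Qed.

(** * Counting pairs of [m]-sets by their intersection *)

Lemma ffact_leX (l n k : nat) : (l <= n)%N -> (l ^_ k <= n ^ k)%N.
Proof.
move=> ln; rewrite ffact_prod -[k in X in (_ <= X)%N]card_ord -prod_nat_const.
by apply: leq_prod => i _; apply: leq_trans ln; exact: leq_subr.
Qed.

(** Adjoining [D] is a bijection from the [(s - #|D|)]-subsets of the complement of [D]. *)
Lemma card_supersets (T : finType) (D : {set T}) (s : nat) : (#|D| <= s)%N ->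
  #|[set A : {set T} | (D \subset A) && (#|A| == s)]%SET| = 'C(#|T| - #|D|, s - #|D|).
Proof.
move=> Ds; rewrite (_ : #|T| - #|D| = #|~: D|)%N; last by rewrite [RHS]cardsCs finset.setCK.
rewrite -cards_draws.
rewrite -[RHS](card_in_imset (f := fun A => A :|: D)); last first.
  move=> A B; rewrite !inE => /andP[AD _] /andP[BD _] /(congr1 (fun X => X :\: D)) /=.
  have sub (X : {set T}) : X \subset ~: D -> (X :|: D) :\: D = X.
    by move=> XD; rewrite finset.setDUl finset.setDv finset.setU0; apply/finset.setDidPl; rewrite finset.disjoints_subset.
  by rewrite !sub.
apply: eq_card => A; apply/idP/imsetP => [|[B]]; rewrite !inE.
  move=> /andP[DA /eqP As]; exists (A :\: D); last first.
    by apply/setP => x; rewrite !inE; case: (boolP (x \in D)) => //= xD; rewrite ?orbF// (fintype.subsetP DA).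
  by rewrite inE finset.subsetDr cardsD (finset.setIidPr DA) As eqxx.
move=> /andP[BD /eqP Bs] ->; rewrite finset.subsetUr cardsU Bs.
have BD0 : B :&: D = finset.set0 by apply/eqP; rewrite finset.setI_eq0 finset.disjoints_subset.
by rewrite BD0 finset.cards0 subn0 subnK ?finset.subsetUr /=.
Qed.

Section PairCounts.
Variables (n m : nat).
Let F := [set B : {set 'I_n} | #|B| == m]%SET.

Lemma sum_pair_superset (D : {set 'I_n}) :
  (\sum_(B in F) \sum_(C in F) (D \subset B) * (D \subset C))%N
  = (#|[set A : {set 'I_n} | (D \subset A) && (#|A| == m)]%SET| ^ 2)%N.
Proof.
rewrite -big_distrlr/= -mulnn.
by congr (_ * _)%N; rewrite -sum1_card big_mkcond [RHS]big_mkcond/=;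
  apply: eq_bigr => B _; rewrite !inE andbC; case: (#|B| == m); case: (D \subset B).
Qed.

(** Sum over the common points: each point lies in [C(n-1, m-1) <= n^(m-1) / (m-1)!] sets of size
    [m], hence in the square of that many pairs. This count yields the main term. *)
Lemma sum_pair_cardI : (0 < m)%N ->
  ((\sum_(B in F) \sum_(C in F) #|B :&: C|) * (m.-1)`! ^ 2 <= n ^ (2 * m - 1))%N.
Proof.
move=> m0.
have -> : (\sum_(B in F) \sum_(C in F) #|B :&: C|
  = \sum_(i < n) \sum_(B in F) \sum_(C in F) ([set i]%SET \subset B) * ([set i]%SET \subset C))%N.
  rewrite [RHS]exchange_big/=; apply: eq_bigr => B _.
  rewrite [RHS]exchange_big/=; apply: eq_bigr => C _.
  rewrite -sum1_card big_mkcond/=; apply: eq_bigr => i _.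
  by rewrite !inE !finset.sub1set; case: (i \in B); case: (i \in C).
rewrite big_distrl/= (_ : 2 * m - 1 = m.-1 * 2 + 1)%N; last by lia.
rewrite expnD expn1 mulnC expnM -[X in (_ <= X * _)%N](card_ord n) -sum_nat_const.
apply: leq_sum => i _; rewrite sum_pair_superset -expnMn leq_sqr.
rewrite card_supersets finset.cards1// card_ord !subn1 bin_ffact.
by rewrite ffact_leX// leq_pred.
Qed.

(** There are [C(n-2, m-2) <= n^(m-2)] such sets, and none if [m < 2]; the factor [n] on the left
    avoids the exponent [m - 2]. *)
Lemma card_superset2_le (i j : 'I_n) : i != j ->
  (n * #|[set A : {set 'I_n} | ([set i; j]%SET \subset A) && (#|A| == m)]%SET| <= n ^ m.-1)%N.
Proof.
move=> ij; have c2 : #|[set i; j]%SET| = 2%N by rewrite cards2 ij.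
have [m2|m2] := leqP 2 m; last first.
  rewrite (_ : [set A | _]%SET = finset.set0) ?finset.cards0 ?muln0//; apply/setP => A; rewrite !inE.
  by apply/negP => /andP[/subset_leq_card + /eqP Am]; rewrite c2 Am leqNgt m2.
rewrite card_supersets c2// card_ord (_ : m.-1 = (m - 2).+1); last by lia.
rewrite expnS leq_mul2l; apply/orP; right.
apply: (@leq_trans ((n - 2) ^_ (m - 2))).
  by rewrite -bin_ffact leq_pmulr ?fact_gt0.
by rewrite ffact_leX// leq_subr.
Qed.

(** The weight [t (t - 1)] counts ordered pairs of distinct common points, and each such pair of
    points contributes at most the square of [n^(m-2)]. This controls the lower-order term, from
    sets meeting in two or more points. *)
Lemma sum_pair_cardI_pred : (0 < m)%N ->
  (\sum_(B in F) \sum_(C in F) #|B :&: C| * #|B :&: C|.-1 <= n ^ (2 * m - 2))%N.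
Proof.
move=> m0.
have -> : (\sum_(B in F) \sum_(C in F) #|B :&: C| * #|B :&: C|.-1
  = \sum_(i < n) \sum_(j < n | i != j) \sum_(B in F) \sum_(C in F)
     ([set i; j]%SET \subset B) * ([set i; j]%SET \subset C))%N.
  under [RHS]eq_bigr do rewrite exchange_big/=.
  rewrite [RHS]exchange_big/=; apply: eq_bigr => B _.
  under [RHS]eq_bigr do rewrite exchange_big/=.
  rewrite [RHS]exchange_big/=; apply: eq_bigr => C _.
  rewrite -sum_nat_const big_mkcond/=; apply: eq_bigr => i _.
  case: ifPn => iBC; last first.
    apply/esym/big1 => j _; move: iBC; rewrite !inE !finset.subUset !finset.sub1set.
    by case: (i \in B); case: (i \in C); rewrite ?muln0.
  rewrite [in LHS](cardsD1 i) iBC/= -sum1_card big_mkcond [RHS]big_mkcond/=.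
  apply: eq_bigr => j _; move: iBC; rewrite !inE !finset.subUset !finset.sub1set eq_sym => /andP[-> ->]/=.
  by case: (i == j); case: (j \in B); case: (j \in C).
have [n0|n0] := posnP n.
  by rewrite big1// => i; have := leq_ltn_trans (leq0n i) (ltn_ord i); rewrite [X in (_ < X)%N]n0.
(* Each [i], and then each [j], is shown to use at most its equal share, rounded down, of the
   total. *)
apply: (@leq_trans (\sum_(i < n) n ^ (2 * m - 2) %/ n)); last first.
  by rewrite sum_nat_const card_ord mulnC leq_trunc_div.
apply: leq_sum => i _; rewrite leq_divRL//.
apply: (@leq_trans ((\sum_(j < n) n ^ (2 * m - 2) %/ n ^ 2) * n)); last first.
  by rewrite sum_nat_const card_ord mulnAC mulnn mulnC leq_trunc_div.
rewrite leq_mul2r; apply/orP; right.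
rewrite big_mkcond; apply: leq_sum => j _; case: ifP => // ij.
rewrite sum_pair_superset leq_divRL ?expn_gt0 ?n0// -expnMn (_ : 2 * m - 2 = m.-1 * 2)%N; last by lia.
by rewrite expnM leq_sqr mulnC card_superset2_le.
Qed.

End PairCounts.

(** * Second moment of elementary symmetric sums *)

Lemma sum_sqr_expand (R : realType) (T I : finType) (G : {set T}) (F : {set I})
    (b : I -> R) (s : T -> I -> R) :
  \sum_(A in G) (\sum_(B in F) b B * s A B) ^+ 2 =
  \sum_(B in F) \sum_(C in F) b B * b C * \sum_(A in G) s A B * s A C.
Proof.
under eq_bigr do rewrite expr2 big_distrlr/=.
rewrite exchange_big/=; apply: eq_bigr => B _.
rewrite exchange_big/=; apply: eq_bigr => C _.
by rewrite mulr_sumr; apply: eq_bigr => A _; ring.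
Qed.

(** [p j] is the fraction of members of [G] containing a given set of [j] points. The centering [r]
    may differ from [p m], so that slices of different sizes can share one centre. *)
Lemma sum_incidence (R : realType) (T : finType) (G : {set {set T}}) (p : nat -> R)
    (r : R) (m : nat) (B C : {set T}) :
  (forall D : {set T}, (#|D| <= 2 * m)%N ->
    #|[set A in G | D \subset A]%SET|%:R = p #|D| * #|G|%:R) ->
  #|B| = m -> #|C| = m ->
  \sum_(A in G) ((B \subset A)%:R - r) * ((C \subset A)%:R - r) =
  #|G|%:R * (p #|B :|: C| - 2 * r * p m + r ^+ 2).
Proof.
move=> hp Bm Cm.
have cnt (D : {set T}) : (#|D| <= 2 * m)%N ->
    \sum_(A in G) (D \subset A)%:R = p #|D| * #|G|%:R.
  move=> /hp <-; rewrite -sum1_card natr_sum big_mkcond [RHS]big_mkcond/=.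
  by apply: eq_bigr => A _; rewrite !inE; case: (A \in G); case: (D \subset A).
have -> : \sum_(A in G) ((B \subset A)%:R - r) * ((C \subset A)%:R - r) =
    \sum_(A in G) ((B :|: C \subset A)%:R - r * (B \subset A)%:R - r * (C \subset A)%:R + r ^+ 2).
  apply: eq_bigr => A _; rewrite finset.subUset.
  by case: (B \subset A); case: (C \subset A) => /=; ring.
rewrite big_split/= !sumrB -!mulr_sumr !cnt ?Bm ?Cm ?sumr_const; last 3 first.
- by lia.
- by lia.
- by rewrite cardsU; lia.
by rewrite -[_ *+ #|_|]mulr_natl; ring.
Qed.

(** The three bounds on [p] treat the pairs of [m]-sets that are disjoint, that meet in one point,
    and all others. They become the three summands on the right, of which the middle one is the main
    term. *)
Lemma second_moment (R : realType) (n m : nat) (a : 'I_n -> R) (M : R)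
    (G : {set {set 'I_n}}) (p : nat -> R) (r d g : R) : (0 < m)%N ->
  (forall i, 0 <= a i <= M) -> 0 <= d -> 0 <= g ->
  (forall D : {set 'I_n}, (#|D| <= 2 * m)%N ->
    #|[set A in G | D \subset A]%SET|%:R = p #|D| * #|G|%:R) ->
  p (2 * m)%N - 2 * r * p m + r ^+ 2 <= d ->
  p (2 * m - 1)%N - 2 * r * p m + r ^+ 2 <= d + g ->
  (forall j, p j - 2 * r * p m + r ^+ 2 <= d + 2) ->
  \sum_(A in G) (\sum_(B : {set 'I_n} | (B \subset A) && (#|B| == m)) \prod_(i in B) a i
     - r * \sum_(B : {set 'I_n} | #|B| == m) \prod_(i in B) a i) ^+ 2
  <= #|G|%:R * (M ^+ (2 * m) * (d * n%:R ^+ (2 * m)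
      + g * n%:R ^+ (2 * m - 1) / (m.-1)`!%:R ^+ 2 + n%:R ^+ (2 * m - 2))).
Proof.
move=> m0 aM d0 g0 hp h0 h1 h2.
pose F := [set B : {set 'I_n} | #|B| == m]%SET.
pose b (B : {set 'I_n}) := \prod_(i in B) a i.
have b0 B : 0 <= b B by apply: prodr_ge0 => i _; have /andP[] := aM i.
have bM B : B \in F -> b B <= M ^+ m.
  rewrite inE => /eqP <-; rewrite -prodr_const; exact: ler_prod.
have FC B C : B \in F -> C \in F -> (#|B :|: C| = 2 * m - #|B :&: C|)%N.
  by rewrite !inE => /eqP Bm /eqP Cm; rewrite cardsU Bm Cm; lia.
pose t B C := #|B :&: C : {set 'I_n}|.
rewrite (eq_bigr (fun A : {set 'I_n} => (\sum_(B in F) b B * ((B \subset A)%:R - r)) ^+ 2)); last first.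
  move=> A _; congr (_ ^+ 2).
  under [RHS]eq_bigr do rewrite mulrBr.
  rewrite sumrB mulr_sumr; congr (_ - _).
    rewrite big_mkcond [RHS]big_mkcond/=; apply: eq_bigr => B _; rewrite inE.
    by case: (B \subset A); case: (#|B| == m); rewrite ?mulr1 ?mulr0.
  by apply: eq_big => [B|B _]; rewrite ?inE// mulrC.
rewrite sum_sqr_expand.
(* With [t] common points, the weight is [d] for [t = 0], [d + g] for [t = 1], and at least [d + 2]
   for [t >= 2]; its sum reduces to the pair counts above. *)
pose w B C : R := d + g * (t B C)%:R + (t B C * (t B C).-1)%:R.
apply: (@le_trans _ _ (\sum_(B in F) \sum_(C in F) #|G|%:R * M ^+ (2 * m) * w B C)).
  apply: ler_sum => B BF; apply: ler_sum => C CF.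
  rewrite (sum_incidence _ hp); last 2 first.
  - by move: BF; rewrite inE => /eqP.
  - by move: CF; rewrite inE => /eqP.
  rewrite mulrCA -[leRHS]mulrA ler_wpM2l//.
  have w0 : 0 <= w B C by rewrite !addr_ge0// mulr_ge0.
  apply: (@le_trans _ _ (b B * b C * w B C)); last first.
    by rewrite ler_wpM2r// mulnC exprM expr2 ler_pM ?bM.
  rewrite ler_wpM2l ?mulr_ge0// FC// /w -/(t B C).
  case: (t B C) => [|[|l]].
  - by rewrite subn0 mulr0 !addr0.
  - by rewrite mulr1 mul1n addr0.
  apply: le_trans (h2 _) _; rewrite -addrA lerD2l -[leLHS]add0r lerD ?mulr_ge0//.
  by rewrite ler_nat; lia.
under eq_bigr do rewrite -mulr_sumr.
rewrite -mulr_sumr -mulrA ler_wpM2l// ler_wpM2l//.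
  by rewrite mulnC exprM sqr_ge0.
under eq_bigr do rewrite 2!big_split/= -mulr_sumr -!natr_sum.
rewrite 2!big_split/= -mulr_sumr -!natr_sum.
apply: lerD; first apply: lerD.
- rewrite !sumr_const -mulrnA -[_ *+ _]mulr_natr ler_wpM2l//.
  rewrite -natrX ler_nat mulnC expnM -mulnn.
  suff Fn : (#|F| <= n ^ m)%N by rewrite leq_mul.
  rewrite /F (_ : [set B | _]%SET = [set B : {set 'I_n} | (finset.set0 \subset B) && (#|B| == m)]%SET).
    rewrite card_supersets finset.cards0// card_ord !subn0.
    apply: leq_trans (ffact_leX m (leqnn n)).
    by rewrite -bin_ffact leq_pmulr ?fact_gt0.
  by apply/setP => B; rewrite !inE finset.sub0set.
- rewrite -mulrA ler_wpM2l// ler_pdivlMr ?exprn_gt0 ?ltr0n ?fact_gt0//.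
  by rewrite -!natrX -natrM ler_nat sum_pair_cardI.
by rewrite -natrX ler_nat sum_pair_cardI_pred.
Qed.

(** * Inclusion probabilities in a slice *)

(** Both sides count the [s]-sets with an ordered choice of [j] distinct points inside. *)
Lemma mul_bin_ffact (n s j : nat) : (j <= s)%N ->
  ('C(n, s) * s ^_ j = n ^_ j * 'C(n - j, s - j))%N.
Proof.
elim: j => [|j IH] js; first by rewrite !ffactn0 !subn0 muln1 mul1n.
rewrite !ffactnSr mulnA IH ?(ltnW js)// -!mulnA; congr (_ * _)%N.
rewrite mulnC -(subnSK js) -mul_bin_diag.
by case: (n - j)%N (subnS n j) => [|l] /= ->; rewrite ?mul0n.
Qed.

(* The probability that a random [s]-subset of an [n]-set contains a given set
   of [j] elements. *)
Definition incl_prob (R : realType) (n s j : nat) : R :=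
  \prod_(i < j) ((s - i)%:R / (n - i)%:R).

Lemma incl_probE (R : realType) (n s j : nat) :
  incl_prob R n s j = (s ^_ j)%:R / (n ^_ j)%:R.
Proof. by rewrite /incl_prob prodf_div !ffact_prod !natr_prod. Qed.

Lemma incl_probS (R : realType) (n s j : nat) :
  incl_prob R n s j.+1 = incl_prob R n s j * ((s - j)%:R / (n - j)%:R).
Proof. by rewrite /incl_prob big_ord_recr. Qed.

Lemma card_slice_incl (R : realType) (n s : nat) (D : {set 'I_n}) :
  #|[set A in [set A : {set 'I_n} | #|A| == s]%SET | D \subset A]%SET|%:R =
  incl_prob R n s #|D| * #|[set A : {set 'I_n} | #|A| == s]%SET|%:R.
Proof.
have -> : [set A in [set A : {set 'I_n} | #|A| == s]%SET | D \subset A]%SET =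
    [set A : {set 'I_n} | (D \subset A) && (#|A| == s)]%SET.
  by apply/setP => A; rewrite !inE andbC.
have -> : [set A : {set 'I_n} | #|A| == s]%SET =
    [set A : {set 'I_n} | (finset.set0 \subset A) && (#|A| == s)]%SET.
  by apply/setP => A; rewrite !inE finset.sub0set.
rewrite [X in _ * X%:R]card_supersets finset.cards0// !subn0 card_ord incl_probE.
have Dn : (#|D| <= n)%N by rewrite -[X in (_ <= X)%N]card_ord max_card.
have [Ds|Ds] := leqP #|D| s.
  rewrite card_supersets// card_ord mulrAC; apply: (mulIf (x := (n ^_ #|D|)%:R)).
    by rewrite pnatr_eq0 -lt0n ffact_gt0.
  rewrite divfK; last by rewrite pnatr_eq0 -lt0n ffact_gt0.
  by rewrite -!natrM [in RHS]mulnC mul_bin_ffact// mulnC.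
rewrite ffact_small// !mul0r (_ : [set A | _]%SET = finset.set0) ?finset.cards0//.
apply/setP => A; rewrite !inE; apply/negP => /andP[/subset_leq_card DA /eqP As].
by move: DA; rewrite As leqNgt Ds.
Qed.

Lemma incl_prob_ge0 (R : realType) (n s j : nat) : 0 <= incl_prob R n s j.
Proof. by apply: prodr_ge0 => i _; rewrite divr_ge0. Qed.

Lemma incl_prob_le1 (R : realType) (n s j : nat) : (s <= n)%N -> incl_prob R n s j <= 1.
Proof.
move=> sn; elim: j => [|j IH]; first by rewrite /incl_prob big_ord0.
rewrite incl_probS mulr_ile1 ?incl_prob_ge0 ?divr_ge0//.
(* If [n - j] is truncated to 0, the factor is 0, as division by zero gives zero. *)
have [nj|nj] := posnP (n - j); first by rewrite nj invr0 mulr0.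
by rewrite ler_pdivrMr ?ltr0n// mul1r ler_nat leq_sub2r.
Qed.

Section InclProb.
Variables (R : realType) (n s : nat).
Hypothesis sn : (s <= n)%N.

Lemma incl_factor_le i j : (i <= j)%N -> (j < n)%N ->
  0 <= ((s - j)%:R / (n - j)%:R : R) <= (s - i)%:R / (n - i)%:R.
Proof.
move=> ij jn; apply/andP; split; first by rewrite divr_ge0.
rewrite ler_pdivrMr ?ltr0n ?subn_gt0// mulrAC ler_pdivlMr ?ltr0n ?subn_gt0//; last by lia.
rewrite -!natrM ler_nat; nia.
Qed.

Lemma incl_prob_le_exp (l : R) j : s%:R <= l * n%:R -> (j <= n)%N -> incl_prob R n s j <= l ^+ j.
Proof.
move=> sl jn; rewrite -[j in leRHS]card_ord -prodr_const; apply: ler_prod => i _.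
have i_n : (i < n)%N by rewrite (leq_trans (ltn_ord i)).
have /andP[-> /le_trans] := incl_factor_le (leq0n i) i_n; apply.
by rewrite !subn0 ler_pdivrMr// ltr0n; lia.
Qed.

(** The last [j] factors are dominated by the first [j]. This negative correlation bounds the
    contribution of disjoint pairs. *)
Lemma incl_prob_double j : (2 * j <= n)%N -> incl_prob R n s (2 * j) <= incl_prob R n s j ^+ 2.
Proof.
move=> jn; rewrite mul2n -addnn /incl_prob big_split_ord/= expr2.
rewrite ler_wpM2l//; first by apply: prodr_ge0 => i _; rewrite divr_ge0.
by apply: ler_prod => i _; apply: incl_factor_le; have := ltn_ord i; lia.
Qed.

(** The product changes by one factor at a time; all denominators are at least [n/2], so each change
    costs at most [2 (s - t) / n]. *)
Lemma incl_prob_lipschitz t j : (2 * j <= n)%N -> (t <= s)%N ->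
  `|incl_prob R n s j - incl_prob R n t j| <= 2 * j%:R * (s - t)%:R / n%:R.
Proof.
elim: j => [|j IH] jn ts.
  by rewrite /incl_prob !big_ord0 subrr normr0 mulr0 mul0r.
have n0 : (0 : R) < n%:R by rewrite ltr0n; lia.
rewrite !incl_probS.
set x := incl_prob _ _ s j; set y := incl_prob _ _ t j.
set u : R := (s - j)%:R / _; set w : R := (t - j)%:R / _.
have {}IH : `|x - y| <= 2 * j%:R * (s - t)%:R / n%:R by apply: IH => //; lia.
have uw : `|u - w| <= 2 * (s - t)%:R / n%:R.
  rewrite -mulrBl normrM [`|_^-1|]ger0_norm ?invr_ge0// ger0_norm; last first.
    by rewrite subr_ge0 ler_nat leq_sub2r.
  rewrite ler_pdivrMr ?ltr0n; last by lia.
  rewrite mulrAC ler_pdivlMr// -natrB; last by rewrite leq_sub2r.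
  by rewrite -!natrM ler_nat; nia.
have u01 : 0 <= u <= 1.
  by rewrite divr_ge0//= ler_pdivrMr ?ltr0n ?mul1r ?ler_nat//; lia.
have y01 : 0 <= y <= 1 by rewrite incl_prob_ge0 incl_prob_le1// (leq_trans ts).
rewrite (_ : x * u - y * w = (x - y) * u + y * (u - w)); last by ring.
apply: le_trans (ler_normD _ _) _; rewrite [`|_ * u|]normrM [`|y * _|]normrM.
have [/andP[u0 u1] /andP[y0 y1]] := (u01, y01).
rewrite (ger0_norm u0) (ger0_norm y0).
rewrite (_ : 2 * j.+1%:R * _ / _ = 2 * j%:R * (s - t)%:R / n%:R + 2 * (s - t)%:R / n%:R); last by rewrite -natr1; ring.
by apply: lerD; [apply: le_trans IH; rewrite ler_piMr|apply: le_trans uw; rewrite ler_piMl].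
Qed.

End InclProb.

(** * Second moments on a window of sizes and on the whole cube *)

Lemma sum_by_card (R : realType) (n : nat) (P : pred nat) (F : {set 'I_n} -> R) :
  \sum_(A : {set 'I_n} | P #|A|) F A =
  \sum_(s < n.+1 | P s) \sum_(A in [set A : {set 'I_n} | #|A| == s]%SET) F A.
Proof.
have An (A : {set 'I_n}) : (#|A| < n.+1)%N by rewrite ltnS -[X in (_ <= X)%N]card_ord max_card.
rewrite (partition_big (fun A : {set 'I_n} => inord #|A| : 'I_n.+1) (fun s => P s))/=; last first.
  by move=> A PA; rewrite inordK.
apply: eq_bigr => s Ps; apply: eq_bigl => A; rewrite inE -val_eqE/= inordK//.
by case: eqP => [->|]; rewrite ?Ps ?andbF.
Qed.

(** A single coordinate of [elem_sym], with real entries. *)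
Definition elem_sum (R : realType) (n m : nat) (a : 'I_n -> R) (A : {set 'I_n}) : R :=
  \sum_(B : {set 'I_n} | (B \subset A) && (#|B| == m)) \prod_(i in B) a i.

(** [second_moment] is applied to each slice. Disjoint pairs cost at most the squared drift of the
    inclusion probability across the window, so [d = (2 m L / n)^2]; for fixed [L] the term
    [d n^(2m)] has the lower order [n^(2m-2)]. *)
Lemma window_moment (R : realType) (n m L lo s0 : nat) (lambda M : R) (a : 'I_n -> R) :
  (0 < m)%N -> (2 * m <= n)%N -> (s0 <= n)%N -> (s0 <= lo + L)%N ->
  0 <= lambda -> s0%:R <= lambda * n%:R -> (forall i, 0 <= a i <= M) ->
  exists c, \sum_(A : {set 'I_n} | (lo <= #|A| <= s0)%N) (elem_sum m a A - c) ^+ 2 <=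
    #|[set A : {set 'I_n} | (lo <= #|A| <= s0)%N]%SET|%:R *
    (M ^+ (2 * m) * ((2 * m%:R * L%:R / n%:R) ^+ 2 * n%:R ^+ (2 * m)
      + lambda ^+ (2 * m - 1) * n%:R ^+ (2 * m - 1) / (m.-1)`!%:R ^+ 2
      + n%:R ^+ (2 * m - 2))).
Proof.
move=> m0 mn sn0 sL l0 sl aM.
(* The centre is the mean over the top slice, of size [s0], and serves every slice. *)
exists (incl_prob R n s0 m * \sum_(B : {set 'I_n} | #|B| == m) \prod_(i in B) a i).
rewrite -sum1dep_card natr_sum !(sum_by_card (fun s => lo <= s <= s0)%N) mulr_suml.
apply: ler_sum => s /andP[los ss0].
rewrite sumr_const.
have sn : (s <= n)%N by apply: leq_trans sn0.
set r := incl_prob R n s0 m; set q := incl_prob R n s m.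
have r0 : 0 <= r := incl_prob_ge0 _ _ _ _.
have q0 : 0 <= q := incl_prob_ge0 _ _ _ _.
have r1 : r <= 1 by apply: incl_prob_le1.
have q1 : q <= 1 by apply: incl_prob_le1.
have n0 : 0 < n%:R :> R by rewrite ltr0n; lia.
have rq : (r - q) ^+ 2 <= (2 * m%:R * L%:R / n%:R) ^+ 2.
  rewrite -real_normK ?num_real// lerXn2r ?nnegrE ?divr_ge0 ?mulr_ge0//.
  apply: le_trans (incl_prob_lipschitz R sn0 mn ss0) _.
  by rewrite ler_wpM2r ?invr_ge0 ?(ltW n0)// ler_wpM2l ?mulr_ge0// ler_nat; lia.
apply: (second_moment m0 aM (sqr_ge0 _) (exprn_ge0 _ l0) (p := incl_prob R n s)).
- by move=> D _; exact: card_slice_incl.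
- rewrite -/q; have := incl_prob_double R sn mn; rewrite -/q => h.
  by have := rq; move: h; lra.
- rewrite -/q; have sl' : s%:R <= lambda * n%:R by apply: le_trans sl; rewrite ler_nat.
  have h : incl_prob R n s (2 * m - 1) <= lambda ^+ (2 * m - 1) by apply: incl_prob_le_exp => //; lia.
  have := sqr_ge0 q; have : (r - q) ^+ 2 = r ^+ 2 - 2 * r * q + q ^+ 2 by ring.
  by move: rq h; lra.
move=> j; rewrite -/q; have := incl_prob_le1 R j sn.
have : 0 <= (2 * m%:R * L%:R / n%:R : R) ^+ 2 by exact: sqr_ge0.
by move=> ? ?; nra.
Qed.

(** In a uniform random subset the points are independent: disjoint pairs have covariance 0, and
    pairs sharing one point have [2^(1-2m) - 4^(-m) = 4^(-m)]. *)
Lemma cube_moment (R : realType) (n m : nat) (M : R) (a : 'I_n -> R) :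
  (0 < m)%N -> (2 * m <= n)%N -> (forall i, 0 <= a i <= M) ->
  exists c, \sum_(A : {set 'I_n}) (elem_sum m a A - c) ^+ 2 <=
    2 ^+ n * (M ^+ (2 * m) *
      ((1 / 4) ^+ m * n%:R ^+ (2 * m - 1) / (m.-1)`!%:R ^+ 2 + n%:R ^+ (2 * m - 2))).
Proof.
move=> m0 mn aM.
exists ((1 / 2) ^+ m * \sum_(B : {set 'I_n} | #|B| == m) \prod_(i in B) a i).
have card2 : #|[set: {set 'I_n}]%SET|%:R = 2 ^+ n :> R.
  by rewrite -powersetT card_powerset cardsT card_ord natrX.
have sq : ((1 / 2) ^+ m) ^+ 2 = (1 / 4) ^+ m :> R.
  by rewrite exprAC; congr (_ ^+ _); lra.
have hp : forall D : {set 'I_n}, (#|D| <= 2 * m)%N ->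
    #|[set A in [set: {set 'I_n}] | D \subset A]%SET|%:R =
      (1 / 2) ^+ #|D| * #|[set: {set 'I_n}]%SET|%:R :> R.
  move=> D _; rewrite card2.
  have -> : [set A in [set: {set 'I_n}] | D \subset A]%SET = [set ~: B | B in powerset (~: D)]%SET.
    apply/setP => A; rewrite !inE/=; apply/idP/imsetP => [DA|[B]].
      by exists (~: A); rewrite ?finset.setCK// inE finset.setCS.
    by rewrite inE => BD ->; rewrite -finset.setCS finset.setCK.
  rewrite card_imset; last exact: finset.setC_inj.
  rewrite card_powerset [#|~: D|]cardsCs finset.setCK card_ord natrX.
  have Dn : (#|D| <= n)%N by rewrite -[X in (_ <= X)%N]card_ord max_card.
  rewrite [X in _ = _ * X](_ : _ = 2 ^+ (#|D| + (n - #|D|))); last by rewrite subnKC.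
  rewrite exprD mulrA -exprMn.
  by rewrite (_ : 1 / 2 * 2 = 1 :> R) ?expr1n ?mul1r//; lra.
have h := @second_moment R n m a M [set: {set 'I_n}]%SET (fun j => (1 / 2) ^+ j) ((1 / 2) ^+ m)
  0 ((1 / 4) ^+ m) m0 aM (lexx _) _ hp.
have e : \sum_(A : {set 'I_n}) (elem_sum m a A -
    (1 / 2) ^+ m * \sum_(B : {set 'I_n} | #|B| == m) \prod_(i in B) a i) ^+ 2 =
  \sum_(A in [set: {set 'I_n}]%SET) (elem_sum m a A -
    (1 / 2) ^+ m * \sum_(B : {set 'I_n} | #|B| == m) \prod_(i in B) a i) ^+ 2.
  by apply: eq_bigl => A; rewrite inE.
rewrite e -card2; move: h; rewrite mul0r [0 + _ / _]add0r; apply => [|||j].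
- by rewrite exprn_ge0//; lra.
- have -> : (1 / 2) ^+ (2 * m) = (1 / 4) ^+ m :> R by rewrite -sq mulnC exprM.
  by rewrite -sq; lra.
- have -> : (1 / 2) ^+ (2 * m - 1) = 2 * (1 / 4) ^+ m :> R.
    rewrite -sq -exprM (_ : m * 2 = (2 * m - 1).+1)%N; last by lia.
    by rewrite exprS mulrA (_ : 2 * (1 / 2) = 1 :> R) ?mul1r//; lra.
  by rewrite -sq; lra.
have : 0 <= (1 / 2 : R) ^+ m by apply: exprn_ge0; lra.
have : (1 / 2 : R) ^+ j <= 1 by apply: exprn_ile1; lra.
by move=> ? ?; have := sqr_ge0 ((1 / 2 : R) ^+ m); lra.
Qed.

(** * Sizes of Hamming balls *)

Lemma card_ballS (n s : nat) :
  (#|[set A : {set 'I_n} | (#|A| <= s.+1)%N]%SET| =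
   #|[set A : {set 'I_n} | (#|A| <= s)%N]%SET| + 'C(n, s.+1))%N.
Proof.
rewrite -[X in 'C(X, _)]card_ord -card_draws -cardsUI.
rewrite [_ :&: _](_ : _ = finset.set0) ?finset.cards0 ?addn0.
  by apply: eq_card => A; rewrite !inE leq_eqVlt orbC.
by apply/setP => A; rewrite !inE; apply/negP => /andP[h /eqP e]; rewrite e ltnn in h.
Qed.

(** The ratio is [(s + 1) / (n - s)], and [s + 1 <= lambda n] gives [n - s >= (1 - lambda) n]. *)
Lemma bin_ratio_le (R : realType) (n s : nat) (lambda : R) : lambda < 1 -> s.+1%:R <= lambda * n%:R ->
  'C(n, s)%:R <= lambda / (1 - lambda) * 'C(n, s.+1)%:R.
Proof.
move=> l1 sl; have sn : (s < n)%N.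
  by rewrite -(ltr_nat R) -natr1 in sl *; have := ler0n R n; nra.
have := congr1 (fun x => x%:R : R) (mul_bin_left n s); rewrite /= !natrM natrB ?(ltnW sn)//.
set x := 'C(n, s)%:R; set y := 'C(n, s.+1)%:R => e.
have x0 : 0 <= x by []. have y0 : 0 <= y by [].
rewrite mulrAC ler_pdivlMr ?subr_gt0//.
have sn' : (s.+1%:R : R) <= n%:R by rewrite ler_nat.
have n0 : (0 : R) < n%:R by rewrite ltr0n; lia.
rewrite -(ler_pM2l n0).
apply: (@le_trans _ _ (s.+1%:R * y)).
  by rewrite e -natr1 in sl *; nra.
by nra.
Qed.

Lemma card_ball_ratio (R : realType) (n s L : nat) (lambda : R) : 0 <= lambda -> lambda < 1 ->
  (s + L)%:R <= lambda * n%:R ->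
  #|[set A : {set 'I_n} | (#|A| <= s)%N]%SET|%:R <=
    (lambda / (1 - lambda)) ^+ L * #|[set A : {set 'I_n} | (#|A| <= s + L)%N]%SET|%:R.
Proof.
move=> l0 l1; have r0 : 0 <= lambda / (1 - lambda) by rewrite divr_ge0// subr_ge0 ltW.
have step t : t.+1%:R <= lambda * n%:R ->
    #|[set A : {set 'I_n} | (#|A| <= t)%N]%SET|%:R <=
      lambda / (1 - lambda) * #|[set A : {set 'I_n} | (#|A| <= t.+1)%N]%SET|%:R.
  elim: t => [|t IH] tl; last first.
    rewrite card_ballS [X in _ * X%:R]card_ballS !natrD mulrDr lerD ?bin_ratio_le//.
    by apply: IH; apply: le_trans tl; rewrite ler_nat.
  have -> : [set A : {set 'I_n} | (#|A| <= 0)%N]%SET = [set finset.set0]%SET.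
    by apply/setP => A; rewrite !inE leqn0 cards_eq0.
  rewrite finset.cards1; apply: (@le_trans _ _ 'C(n, 0)%:R); first by rewrite bin0.
  apply: le_trans (bin_ratio_le l1 tl) _; rewrite ler_wpM2l// ler_nat.
  by rewrite card_ballS leq_addl.
elim: L => [|L IH] sl; first by rewrite expr0 mul1r addn0.
rewrite addnS in sl *; apply: le_trans (IH _) _; first by apply: le_trans sl; rewrite ler_nat.
by rewrite exprSr -mulrA ler_wpM2l ?exprn_ge0// step.
Qed.

Lemma exists_exp_le (R : realType) (x e : R) : 0 <= x < 1 -> 0 < e -> exists L, x ^+ L <= e.
Proof.
move=> /andP[x0 x1] e0.
have : x ^+ n @[n --> \oo] --> (0 : R) by apply: cvg_expr; rewrite ger0_norm.
move/cvgrPdist_le => /(_ _ e0)[L _ /(_ L (leqnn L))/=].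
by rewrite sub0r normrN ger0_norm ?exprn_ge0// => ?; exists L.
Qed.

Lemma eventually_ge_linear (R : realType) (x e : R) : 0 < e ->
  exists n0, forall n, (n0 <= n)%N -> x <= e * n%:R.
Proof.
move=> e0; exists (Num.truncn (x / e)).+1 => n n0.
rewrite -ler_pdivrMl// mulrC; apply: (@le_trans _ _ (Num.truncn (x / e)).+1%:R); last by rewrite ler_nat.
exact/ltW/truncnS_gt.
Qed.

(** Of a set and its complement, one has size at most [n/2]. *)
Lemma card_small_sets_ge (R : realType) (lambda : R) (n : nat) : 1 / 2 <= lambda ->
  (2 ^ n <= 2 * #|small_sets lambda n|)%N.
Proof.
move=> l2; have -> : (2 ^ n = #|[set: {set 'I_n}]%SET|)%N.
  by rewrite -powersetT card_powerset cardsT card_ord.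
set S := small_sets lambda n.
have cS : [set: {set 'I_n}]%SET \subset S :|: [set ~: B | B in S]%SET.
  apply/fintype.subsetP => A _; rewrite finset.in_setU.
  have cA : (#|A| + #|~: A| = n)%N by rewrite cardsC card_ord.
  have [Ah|Ah] := leqP (#|A| * 2) n; apply/orP; [left|right].
    rewrite inE; apply: (@le_trans _ _ (1 / 2 * n%:R)); last by rewrite ler_wpM2r.
    by rewrite -(ler_nat R) natrM in Ah; lra.
  apply/imsetP; exists (~: A); last by rewrite finset.setCK.
  rewrite inE; apply: (@le_trans _ _ (1 / 2 * n%:R)); last by rewrite ler_wpM2r.
  have h : (#|~: A| * 2 <= n)%N by lia.
  by rewrite -(ler_nat R) natrM in h; lra.
apply: leq_trans (subset_leq_card cS) _; apply: leq_trans (leq_card_setU _ _) _.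
by rewrite mul2n -addnn leq_add2l leq_imset_card.
Qed.

(** * Large families with small second moment *)

(** What the final count needs, in one form for both ranges of [lambda]. The factor
    [lambda^(2m-1) + lambda^(2m)] is the one in [bound_const], and [101/100] leaves room for
    lower-order terms. *)
Definition spread_family (R : realType) (m : nat) (lambda : R) (n : nat)
    (G : {set {set 'I_n}}) : Prop :=
  [/\ G \subset small_sets lambda n,
      forall A, A \in G -> (m <= #|A|)%N,
      99 / 100 * #|small_sets lambda n|%:R <= #|G|%:R :> R &
      forall (M : R) (a : 'I_n -> R), (forall i, 0 <= a i <= M) ->
      exists c, \sum_(A in G) (elem_sum m a A - c) ^+ 2 <= #|G|%:R *
        (101 / 100 * (lambda ^+ (2 * m - 1) + lambda ^+ (2 * m)) *
          (M ^+ (2 * m) * n%:R ^+ (2 * m - 1) / (m.-1)`!%:R ^+ 2))].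

Lemma spread_family_lt_half (R : realType) (m : nat) (lambda : R) : (0 < m)%N ->
  0 < lambda -> lambda < 1 / 2 ->
  exists n0, forall n, (n0 <= n)%N -> exists G : {set {set 'I_n}}, spread_family m lambda G.
Proof.
move=> m0 l0 l2.
have l1 : lambda < 1 by lra.
have rho1 : 0 <= lambda / (1 - lambda) < 1.
  by rewrite divr_ge0 ?(ltW l0) ?subr_ge0 ?(ltW l1)//= ltr_pdivrMr ?subr_gt0// mul1r; lra.
(* The width [L] does not depend on [n]; the ball below the window holds at most one percent of the
   small sets. *)
have [L rL] : exists L, (lambda / (1 - lambda)) ^+ L <= 1 / 100.
  by apply: exists_exp_le => //; lra.
set f : R := (m.-1)`!%:R ^+ 2.
have f0 : 0 < f by rewrite exprn_gt0// ltr0n fact_gt0.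
set kap := lambda ^+ (2 * m - 1).
have k0 : 0 < kap by rewrite exprn_gt0.
have [n1 hn1] : exists n1, forall n, (n1 <= n)%N ->
    ((2 * m%:R * L%:R) ^+ 2 + 1) * f <= 1 / 100 * kap * n%:R.
  by apply: eventually_ge_linear; rewrite mulr_gt0//; lra.
(* Guarantees [L + m <= s0], so that every size in the window is at least [m]. *)
have [n2 hn2] := eventually_ge_linear (L + m)%:R l0.
exists (maxn (2 * m) (maxn n1 n2)) => n; rewrite !geq_max => /and3P[mn /hn1 {}hn1 /hn2 {}hn2].
have n0 : 0 < n%:R :> R by rewrite ltr0n; clear -m0 mn; lia.
set s0 := Num.truncn (lambda * n%:R).
have ln0 : 0 <= lambda * n%:R by rewrite mulr_ge0 ?(ltW l0).
have s0P k : (k <= s0)%N = (k%:R <= lambda * n%:R) by rewrite truncn_ge_nat.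
have s0l : s0%:R <= lambda * n%:R by rewrite -s0P.
have s0n : (s0 <= n)%N.
  by rewrite -(ler_nat R); apply: le_trans s0l _; rewrite ler_piMl// ltW.
have s0L : (L + m <= s0)%N by rewrite s0P.
have smallE : small_sets lambda n = [set A : {set 'I_n} | (#|A| <= s0)%N]%SET.
  by apply/setP => A; rewrite !inE s0P.
pose G := [set A : {set 'I_n} | ((s0 - L).+1 <= #|A| <= s0)%N]%SET.
have cardG : (#|small_sets lambda n| = #|G| + #|[set A : {set 'I_n} | (#|A| <= s0 - L)%N]%SET|)%N.
  rewrite smallE -[LHS](cardsID G); congr (_ + _)%N; apply: eq_card => A; rewrite !inE.
    by rewrite andbC -andbA andbb.
  by move: #|A| (s0) => x y; clear; lia.
exists G; split.
- by rewrite smallE; apply/fintype.subsetP => A; rewrite !inE => /andP[].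
- by move=> A; rewrite inE => /andP[+ _]; apply: leq_trans; move: s0L; clear; move: (s0) => y; lia.
- have := @card_ball_ratio R n (s0 - L) L lambda (ltW l0) l1.
  rewrite subnK; last by rewrite (leq_trans _ s0L)// leq_addr.
  move=> /(_ s0l); rewrite -smallE cardG natrD.
  set x : R := #|G|%:R; set y : R := #|_|%:R; set rL' := _ ^+ L => h.
  have x0 : 0 <= x by []. have y0 : 0 <= y by [].
  by rewrite -/rL' in rL; nra.
move=> M a aM.
have sL : (s0 <= (s0 - L).+1 + L)%N by rewrite addSn leqW// addnC -leq_subLR.
have [c hc] := window_moment m0 mn s0n sL (ltW l0) s0l aM.
exists c; rewrite (eq_bigl (fun A : {set 'I_n} => (s0 - L).+1 <= #|A| <= s0)%N); last first.
  by move=> A; rewrite inE.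
apply: le_trans hc _.
rewrite ler_wpM2l// -/f -/kap.
have M0 : 0 <= M ^+ (2 * m) by rewrite mulnC exprM sqr_ge0.
rewrite (_ : 101 / 100 * (kap + lambda ^+ (2 * m)) * (M ^+ (2 * m) * n%:R ^+ (2 * m - 1) / f) =
  M ^+ (2 * m) * (101 / 100 * (kap + lambda ^+ (2 * m)) * n%:R ^+ (2 * m - 1) / f)); last by ring.
rewrite ler_wpM2l// exprMn exprVn.
rewrite [n%:R ^+ (2 * m)](_ : _ = n%:R ^+ 2 * n%:R ^+ (2 * m - 2)); last first.
  by rewrite -exprD; congr (_ ^+ _); clear -m0; lia.
rewrite [n%:R ^+ (2 * m - 1)](_ : _ = n%:R * n%:R ^+ (2 * m - 2)); last first.
  by rewrite -exprS; congr (_ ^+ _); clear -m0; lia.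
set P : R := n%:R ^+ (2 * m - 2).
have P0 : 0 <= P by rewrite exprn_ge0.
rewrite mulrA divfK ?expf_neq0 ?gt_eqF//.
have h : (2 * m%:R * L%:R) ^+ 2 + 1 <= 1 / 100 * kap * n%:R / f by rewrite ler_pdivlMr.
have lm0 : 0 <= lambda ^+ (2 * m) * n%:R / f by rewrite divr_ge0 ?mulr_ge0 ?exprn_ge0 ?(ltW l0) ?(ltW f0).
set T := (_ * _ * _) ^+ 2 in h *.
rewrite (_ : T * P + kap * (n%:R * P) / f + P = (T + 1 + kap * n%:R / f) * P); last by ring.
rewrite (_ : 101 / 100 * (kap + lambda ^+ (2 * m)) * (n%:R * P) / f =
  (101 / 100 * (kap * n%:R / f) + 101 / 100 * (lambda ^+ (2 * m) * n%:R / f)) * P); last by ring.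
rewrite ler_wpM2r//.
rewrite (_ : 1 / 100 * kap * n%:R / f = 1 / 100 * (kap * n%:R / f)) in h; last by ring.
by move: h lm0; set u := kap * _ / f; set w := _ * _ / f; lra.
Qed.

(** The sum over the family is at most the sum over the cube, which is little more than twice as
    large. The loss of about 2 is paid for by [lambda^(2m-1) + lambda^(2m) >= 3 / 4^m]. *)
Lemma spread_family_ge_half (R : realType) (m : nat) (lambda : R) : (0 < m)%N ->
  1 / 2 <= lambda ->
  exists n0, forall n, (n0 <= n)%N -> exists G : {set {set 'I_n}}, spread_family m lambda G.
Proof.
move=> m0 l2.
set f : R := (m.-1)`!%:R ^+ 2.
have f0 : 0 < f by rewrite exprn_gt0// ltr0n fact_gt0.
pose q : R := (1 / 4) ^+ m.
have q0 : 0 < q by apply: exprn_gt0; lra.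
(* With [x = q n / f], this makes [1 <= 0.45 x], whence [2.03 (x + 1) <= 1.01 * 3 x], the comparison
   that ends the proof. *)
have [n1 hn1] : exists n1, forall n, (n1 <= n)%N -> f <= 45 / 100 * q * n%:R.
  by apply: eventually_ge_linear; rewrite mulr_gt0//; lra.
exists (maxn (4 * (m + 5)) n1) => n; rewrite !geq_max => /andP[mn /hn1 {}hn1].
set S := small_sets lambda n.
pose G := [set A in S | (m <= #|A|)%N]%SET.
have cardG : (#|S| <= #|G| + #|[set A : {set 'I_n} | (#|A| <= m)%N]%SET|)%N.
  rewrite -[leqLHS](cardsID G); apply: leq_add; apply: subset_leq_card; apply/fintype.subsetP => A; rewrite !inE.
    by case/andP.
  by case: (leqP m #|A|) => [|/ltnW ->//]; rewrite andbT => _ /andP[/negP].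
have S2 : (2 : R) ^+ n <= 2 * #|S|%:R.
  by have := card_small_sets_ge n l2; rewrite -(ler_nat R) natrX natrM.
have ball : #|[set A : {set 'I_n} | (#|A| <= m)%N]%SET|%:R <= (1 / 243) * 2 ^+ n :> R.
  (* Since [m + 5 <= n/4], each of five steps gains a factor 3, and [243 = 3^5]. *)
  apply: le_trans (@card_ball_ratio R n m 5 (1 / 4) _ _ _) _; [lra|lra| |].
    have h : (4 * (m + 5))%:R <= n%:R :> R by rewrite ler_nat.
    by rewrite natrM in h; lra.
  apply: ler_pM; rewrite ?exprn_ge0//; first by rewrite divr_ge0; lra.
    by rewrite (_ : 1 / 4 / (1 - 1 / 4) = 1 / 3 :> R); [lra|field].
  have -> : (2 : R) ^+ n = #|[set: {set 'I_n}]%SET|%:R.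
    by rewrite -powersetT card_powerset cardsT card_ord natrX.
  by rewrite ler_nat subset_leq_card// finset.subsetT.
have {}cardG : #|S|%:R <= #|G|%:R + (1 / 243) * 2 ^+ n :> R.
  by move: cardG; rewrite -(ler_nat R) natrD; lra.
exists G; split.
- by apply/fintype.subsetP => A; rewrite inE => /andP[].
- by move=> A; rewrite inE => /andP[].
- by have := ler0n R #|S|; rewrite -/S; lra.
move=> M a aM.
have mn2 : (2 * m <= n)%N by clear -mn; lia.
have [c hc] := cube_moment m0 mn2 aM.
exists c; apply: (@le_trans _ _ (\sum_(A : {set 'I_n}) (elem_sum m a A - c) ^+ 2)).
  by rewrite [leRHS](bigID (mem G))/= lerDl sumr_ge0// => A _; exact: sqr_ge0.
apply: le_trans hc _.
rewrite -/f -/q.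
have M0 : 0 <= M ^+ (2 * m) by rewrite mulnC exprM sqr_ge0.
set kap := lambda ^+ (2 * m - 1).
have kq : 3 * q <= kap + lambda ^+ (2 * m).
  have h2 : (1 / 2 : R) ^+ (2 * m - 1) <= kap by apply: lerXn2r => //; rewrite nnegrE; lra.
  have h3 : (1 / 2 : R) ^+ (2 * m) <= lambda ^+ (2 * m) by apply: lerXn2r => //; rewrite nnegrE; lra.
  have q2 : (1 / 2 : R) ^+ (2 * m) = q.
    by rewrite exprM /q; congr (_ ^+ _); lra.
  have : (1 / 2 : R) ^+ (2 * m) = 1 / 2 * (1 / 2) ^+ (2 * m - 1).
    by rewrite -exprS; congr (_ ^+ _); clear -m0; lia.
  by move: h2 h3; rewrite q2; lra.
rewrite (_ : #|G|%:R * (101 / 100 * (kap + lambda ^+ (2 * m)) * (M ^+ (2 * m) * n%:R ^+ (2 * m - 1) / f)) =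
  M ^+ (2 * m) * (#|G|%:R * (101 / 100 * (kap + lambda ^+ (2 * m)) * n%:R ^+ (2 * m - 1) / f))); last by ring.
rewrite mulrCA ler_wpM2l//.
rewrite [n%:R ^+ (2 * m - 1)](_ : _ = n%:R * n%:R ^+ (2 * m - 2)); last first.
  by rewrite -exprS; congr (_ ^+ _); clear -m0; lia.
set P : R := n%:R ^+ (2 * m - 2).
have P0 : 0 <= P by rewrite exprn_ge0.
have n0 : 0 < n%:R :> R by rewrite ltr0n; clear -m0 mn; lia.
set u := n%:R / f.
have u0 : 0 <= u by rewrite divr_ge0 ?(ltW f0) ?(ltW n0).
have h : 1 <= 45 / 100 * (q * u) by rewrite /u mulrA mulrA ler_pdivlMr ?mul1r// mulrA.
rewrite (_ : q * (n%:R * P) / f + P = (q * u + 1) * P); last by rewrite /u; ring.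
rewrite (_ : 101 / 100 * (kap + lambda ^+ (2 * m)) * (n%:R * P) / f =
  (101 / 100 * ((kap + lambda ^+ (2 * m)) * u)) * P); last by rewrite /u; ring.
rewrite [leLHS]mulrA [leRHS]mulrA ler_wpM2r//.
have G0 : 0 <= #|G|%:R :> R by [].
have g2 : 2 ^+ n <= 203 / 100 * #|G|%:R :> R by lra.
have ku : 3 * (q * u) <= (kap + lambda ^+ (2 * m)) * u by rewrite [leLHS]mulrA ler_wpM2r.
apply: (@le_trans _ _ (203 / 100 * #|G|%:R * (q * u + 1))).
  by rewrite ler_wpM2r// addr_ge0// mulr_ge0// ltW.
rewrite [203 / 100 * _]mulrC -[leLHS]mulrA ler_wpM2l//.
by move: h ku; set x := q * u; set y := _ * u; lra.
Qed.

(** * Comparison of constants and conclusion *)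

(** Dropping the [+ 1] and cancelling [t] reduces the constants for [lambda >= 1/2] to the first
    one: [t = 2^(2m)] at [1/2] and [t = m^2] above. *)
Lemma scaled_fraction_le (R : realType) (g P x y t : R) :
  0 <= g -> 0 < P -> 0 < x -> 0 < y -> 0 < t ->
  t * g / ((2 * t * x + 2 * t * y + 1) * P) <= g / (2 * (x + y) * P).
Proof.
move=> g0 P0 x0 y0 t0.
rewrite ler_pdivrMr ?mulr_gt0 ?addr_gt0 ?mulr_gt0// mulrAC ler_pdivlMr ?mulr_gt0 ?addr_gt0//.
have := mulr_ge0 g0 (ltW P0); set w := g * P => w0.
rewrite (_ : t * g * _ = w * (2 * t * x + 2 * t * y)); last by rewrite /w; ring.
rewrite (_ : g * _ = w * (2 * t * x + 2 * t * y + 1)); last by rewrite /w; ring.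
by rewrite ler_wpM2l// lerDl.
Qed.

Lemma bound_const_le (R : realType) (k m : nat) (lambda : R) : (0 < m)%N -> 0 < lambda ->
  bound_const k m lambda <= m.-1`!%:R ^+ 2 * Gamma (k%:R / 2 + 1) `^ (2 / k%:R) /
    (2 * (lambda ^+ (2 * m - 1) + lambda ^+ (2 * m)) * (pi * (k%:R + 2))).
Proof.
move=> m0 l0; rewrite /bound_const.
set G := Gamma _ `^ _; set P := pi * _; set f := m.-1`!%:R ^+ 2.
set x := lambda ^+ (2 * m - 1); set y := lambda ^+ (2 * m).
have x0 : 0 < x by rewrite exprn_gt0.
have y0 : 0 < y by rewrite exprn_gt0.
have P0 : 0 < P by rewrite mulr_gt0 ?pi_gt0// ltr_wpDl.
have fG : 0 <= f * G by rewrite mulr_ge0 ?sqr_ge0 ?powR_ge0.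
have scaled t := @scaled_fraction_le R (f * G) P x y t fG P0 x0 y0.
case: ifP => // _; case: ifP => _.
  by have := scaled (2 ^+ (2 * m)) (exprn_gt0 _ (ltr0Sn _ _)); rewrite addn1 exprS !mulrA.
have m0' : 0 < (m%:R : R) ^+ 2 by rewrite exprn_gt0// ltr0n.
have := scaled _ m0'.
have -> : m`!%:R ^+ 2 = m%:R ^+ 2 * f :> R.
  by rewrite /f -exprMn -natrM -[in LHS](prednK m0) factS prednK.
by rewrite !mulrA.
Qed.

Lemma powR_card_le (R : realType) (k : nat) (N y : R) : (0 < k)%N -> 0 <= N -> 0 <= y ->
  99 / 100 * N <= expR (k%:R / 2) * y ^+ k ->
  N `^ (2 / k%:R) <= (100 / 99) ^+ 2 * (expR 1 * y ^+ 2).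
Proof.
move=> k0 N0 y0 h.
have k0' : (0 : R) < k%:R by rewrite ltr0n.
have h' : N <= 100 / 99 * (expR (k%:R / 2) * y ^+ k) by lra.
apply: (@le_trans _ _ ((100 / 99 * (expR (k%:R / 2) * y ^+ k)) `^ (2 / k%:R))).
  by apply: ge0_ler_powR => //; rewrite ?nnegrE ?divr_ge0 ?(ltW k0')// (le_trans N0).
have c0 : (0 : R) <= 100 / 99 by lra.
rewrite [(_ * (_ * _)) `^ _]powRM ?mulr_ge0 ?expR_ge0 ?exprn_ge0// [(expR _ * _) `^ _]powRM ?expR_ge0 ?exprn_ge0//.
rewrite -expRM (_ : k%:R / 2 * (2 / k%:R) = 1); last by field; rewrite gt_eqF.
rewrite -(powR_mulrn k y0) -powRrM (_ : k%:R * (2 / k%:R) = 2%:R); last by field; rewrite gt_eqF.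
rewrite powR_mulrn// ler_wpM2r ?mulr_ge0 ?expR_ge0 ?sqr_ge0//.
(* As [k >= 1], the exponent [2/k] is at most 2, which bounds the power of [100/99] uniformly in
   [k]. *)
rewrite -powR_mulrn//. apply: ler_powR; first by lra.
by rewrite ler_pdivrMr// ler_peMr// ler1n.
Qed.

Lemma card_small_sets_ge_n (R : realType) (lambda : R) (n : nat) : 1 <= lambda * n%:R ->
  (n <= #|small_sets lambda n|)%N.
Proof.
move=> ln; rewrite -[n in leqLHS]card_ord -cardsT.
rewrite -(card_imset _ (@finset.set1_inj 'I_n)) subset_leq_card//.
by apply/fintype.subsetP => A /imsetP[i _ ->]; rewrite inE finset.cards1.
Qed.

Lemma bounded_seq_lt1 (R : realType) (M : R) (n k : nat) (a : 'I_n -> {ffun 'I_k -> int}) :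
  bounded_seq M a -> M < 1 -> forall i, a i = 0.
Proof.
move=> aM M1 i; apply/ffunP => j; rewrite ffunE.
have /andP[a0 /le_lt_trans/(_ M1)] := aM i j.
by move: a0; rewrite ler0z ltrz1; move: (a i j) => z; clear; lia.
Qed.

Lemma elem_sum_coord (R : realType) (n k m : nat) (a : 'I_n -> {ffun 'I_k -> int})
    (A : {set 'I_n}) (j : 'I_k) :
  elem_sum m (fun i => (a i j)%:~R : R) A = (elem_sym m a A j)%:~R.
Proof.
by rewrite elem_sym_coord rmorph_sum; apply: eq_bigr => B _; rewrite rmorph_prod.
Qed.

(** The factor [e] from the lattice count cancels the [1/e] of [Gamma_root_le], and [2 pi v] cancels
    the rest of the constant up to numerical factors. [K] only forces [v] to be large. *)
Lemma spread_family_bound (R : realType) (k m n : nat) (lambda M K : R)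
    (G : {set {set 'I_n}}) (a : 'I_n -> {ffun 'I_k -> int}) :
  (0 < k)%N -> (0 < m)%N -> 0 < lambda -> (0 < n)%N -> spread_family m lambda G ->
  bounded_seq M a -> 1 <= M -> {in G &, injective (elem_sym m a)} ->
  500 <= K -> K ^+ 2 <= (lambda ^+ (2 * m - 1) + lambda ^+ (2 * m)) / (m.-1)`!%:R ^+ 2 * n%:R ->
  bound_const k m lambda *
    (#|small_sets lambda n|%:R `^ (2 / k%:R) / n%:R ^+ (2 * m - 1)) <= M ^+ (2 * m).
Proof.
move=> k0 m0 l0 n0 [Gsmall Gm GN Gmom] aM M1 inj K500 nbig.
have n0' : (0 : R) < n%:R by rewrite ltr0n.
have k0' : (0 : R) < k%:R by rewrite ltr0n.
set D := lambda ^+ _ + _ in nbig Gmom *; set f := _`!%:R ^+ 2 in nbig Gmom *.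
have D0 : 0 < D by rewrite addr_gt0 ?exprn_gt0.
have f0 : 0 < f by rewrite exprn_gt0// ltr0n fact_gt0.
pose v := 101 / 100 * D * (M ^+ (2 * m) * n%:R ^+ (2 * m - 1) / f).
have Mm1 : 1 <= M ^+ (2 * m) by rewrite exprn_ege1.
have nm : n%:R <= n%:R ^+ (2 * m - 1) :> R.
  by rewrite -[leLHS]expr1 ler_weXn2l// ?ler1n//; clear -m0; lia.
have vbig : K ^+ 2 <= v.
  apply: le_trans nbig _; rewrite /v (_ : 101 / 100 * D * _ =
    D / f * (101 / 100 * (M ^+ (2 * m) * n%:R ^+ (2 * m - 1)))); last by ring.
  rewrite ler_wpM2l ?divr_ge0 ?(ltW D0) ?(ltW f0)//.
  apply: le_trans nm _; rewrite -[leLHS]mul1r mulrA ler_wpM2r ?exprn_ge0//; lra.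
have v0 : 0 < v.
  by apply: lt_le_trans vbig; rewrite exprn_gt0//; apply: lt_le_trans K500; rewrite ltr0n.
have /choice[c hc] : forall j : 'I_k, exists c,
    \sum_(A in G) ((elem_sym m a A j)%:~R - c) ^+ 2 <= #|G|%:R * v.
  move=> j; have [c hc] := Gmom M (fun i => (a i j)%:~R) (fun i => aM i j).
  by exists c; under eq_bigr do rewrite -elem_sum_coord.
have pos (A : {set 'I_n}) (j : 'I_k) : A \in G -> 0 <= elem_sym m a A j.
  move=> _; rewrite elem_sym_coord; apply: sumr_ge0 => B _; apply: prodr_ge0 => i _.
  by have /andP[] := aM i j; rewrite ler0z.
have cardG := card_le_of_second_moment v0 inj pos hc.
set y := Num.sqrt (2 * pi * v) + 1 in cardG.
(* For [s >= 500], [(s + 1)^2 <= 1.005 s^2]; the additive 1 of the Gaussian sum thus costs half a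
   percent. *)
have y2 : y ^+ 2 <= 201 / 200 * (2 * pi * v).
  have s2 : Num.sqrt (2 * pi * v) ^+ 2 = 2 * pi * v.
    by rewrite sqr_sqrtr//; apply: mulr_ge0; [apply: mulr_ge0 => //; exact: pi_ge0|exact: ltW].
  have s0 : 0 <= Num.sqrt (2 * pi * v) by exact: sqrtr_ge0.
  have pi2 : 2 <= (pi : R) := pi_ge2 R.
  have K0 : 0 <= K by apply: le_trans K500; rewrite ler0n.
  have sK : K <= Num.sqrt (2 * pi * v).
    rewrite -[leLHS](ger0_norm K0) -sqrtr_sqr ler_wsqrtr//; apply: le_trans vbig _.
    rewrite -[leLHS]mul1r ler_wpM2r ?(ltW v0)//. lra.
  have {}sK : 500 <= Num.sqrt (2 * pi * v) by apply: le_trans sK.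
  by move: s2 sK; rewrite /y; set s := Num.sqrt _ => <- sK; nra.
have y0 : 0 <= y by rewrite addr_ge0.
have Nle := powR_card_le k0 (ler0n R #|small_sets lambda n|) y0 (le_trans GN cardG).
set Nk := _ `^ _ in Nle *.
have e0 : (0 : R) < expR 1 := expR_gt0 1.
have pi0 : (0 : R) < pi := pi_gt0 R.
have {}Nle : Nk <= (100 / 99) ^+ 2 * (expR 1 * (201 / 200 * (2 * pi * v))).
  by apply: le_trans Nle _; rewrite ler_wpM2l ?sqr_ge0// ler_wpM2l// ltW.
have C : bound_const k m lambda <= 95 / 100 * f / (2 * D * pi * expR 1).
  apply: le_trans (bound_const_le k m0 l0) _; rewrite -/D -/f.
  move: (pi : R) pi0 => p p0; have := Gamma_root_le R k0; set g := _ `^ _ => gle.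
  have k2 : (0 : R) < k%:R + 2 by rewrite addr_gt0.
  have {}gle : g / (k%:R + 2) <= 95 / 100 / expR 1.
    rewrite ler_pdivrMr//; apply: le_trans gle _; rewrite le_eqVlt; apply/orP; left; apply/eqP.
    by field; exact: lt0r_neq0.
  rewrite (_ : f * g / _ = g / (k%:R + 2) * (f / (2 * D * p))); last first.
    by field; rewrite !lt0r_neq0.
  rewrite (_ : 95 / 100 * f / _ = 95 / 100 / expR 1 * (f / (2 * D * p))); last first.
    by field; rewrite !lt0r_neq0.
  by rewrite ler_wpM2r// divr_ge0 ?(ltW f0)// !mulr_ge0 ?(ltW D0) ?(ltW p0).
have Nk0 : 0 <= Nk by exact: powR_ge0.
have B0 : 0 <= Nk / n%:R ^+ (2 * m - 1) by rewrite divr_ge0 ?exprn_ge0.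
apply: le_trans (ler_wpM2r B0 C) _.
have P0 : 0 < n%:R ^+ (2 * m - 1) :> R by rewrite exprn_gt0.
rewrite mulrA ler_pdivrMr// mulrC -ler_pdivlMr; last by rewrite !(divr_gt0, mulr_gt0).
apply: le_trans Nle _; rewrite /v.
move: (M ^+ (2 * m)) (n%:R ^+ (2 * m - 1)) Mm1 P0 => Z P Z1 P0.
move: (pi : R) pi0 => p p0.
rewrite (_ : Z * P / (95 / 100 * f / _) = 2 * 100 / 95 * (D * p * expR 1 * Z * P / f)); last first.
  by field; rewrite !lt0r_neq0.
(* All losses together give about 2.072, below [200/95], about 2.105. *)
rewrite (_ : (100 / 99) ^+ 2 * _ = ((100 / 99) ^+ 2 * (201 / 200) * 2 * (101 / 100)) * (D * p * expR 1 * Z * P / f)); last first.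
  by field; rewrite !lt0r_neq0.
have Z0 : 0 < Z by apply: lt_le_trans Z1.
by rewrite ler_wpM2r ?divr_ge0 ?mulr_ge0 ?(ltW e0) ?(ltW f0) ?(ltW D0) ?(ltW p0) ?(ltW Z0) ?(ltW P0)//; lra.
Qed.

Theorem theorem3p6 (R : realType) (k m : nat) (lambda : R)
    (hk : (1 <= k)%N) (hm : (1 <= m)%N) (hlambda : 0 < lambda <= 1) :
  exists2 o : nat -> R, o n @[n --> \oo] --> (0 : R) &
  forall (n : nat) (M : R) (a : 'I_n -> {ffun 'I_k -> int}),
    (0 < n)%N ->
    bounded_seq M a ->
    (forall A1 A2 : {set 'I_n},
       A1 \in small_sets lambda n -> A2 \in small_sets lambda n ->
       (m <= #|A1|)%N -> (m <= #|A2|)%N ->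
       A1 <> A2 -> elem_sym m a A1 <> elem_sym m a A2) ->
    M ^+ (2 * m) >=
      bound_const k m lambda *
      ((1 + o n) * #|small_sets lambda n|%:R `^ (2 / k%:R) /
       n%:R ^+ (2 * m - 1)).
Proof.
have k0 : (0 < k)%N by []. have m0 : (0 < m)%N by [].
have /andP[l0 l1] := hlambda.
have [n1 hn1] : exists n1, forall n, (n1 <= n)%N ->
    exists G : {set {set 'I_n}}, spread_family m lambda G.
  have [l2|l2] := ltP lambda (1 / 2); first exact: spread_family_lt_half.
  exact: spread_family_ge_half.
have [n2 hn2] := eventually_ge_linear 1 l0.
have [K K500] : exists K : R, 500 <= K by exists 500.
have D0 : 0 < (lambda ^+ (2 * m - 1) + lambda ^+ (2 * m)) / (m.-1)`!%:R ^+ 2.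
  by rewrite divr_gt0 ?addr_gt0 ?exprn_gt0// ltr0n fact_gt0.
have [n3 hn3] := eventually_ge_linear (K ^+ 2) D0.
(* The bound [2 <= n] serves to exclude [M < 1] below. *)
pose n0 := maxn 2 (maxn n1 (maxn n2 n3)).
exists (fun n => if (n0 <= n)%N then 0 else -1).
  apply: cvg_near_cst; exists n0 => // n /= n0n; by rewrite n0n.
move=> n M a npos aM inj.
have M0 : 0 <= M ^+ (2 * m) by rewrite mulnC exprM sqr_ge0.
case: ifP => [|_]; last by rewrite subrr mul0r mul0r mulr0.
rewrite !geq_max => /and4P[n2' /hn1[G GP] /hn2 {}hn2 /hn3 {}hn3].
have [Gsmall Gm GN _] := GP.
have injG : {in G &, injective (elem_sym m a)}.
  move=> A B AG BG; apply: contra_eq => /eqP AB; apply/eqP.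
  by apply: inj => //; [exact: (fintype.subsetP Gsmall)|exact: (fintype.subsetP Gsmall)|exact: Gm|exact: Gm].
(* If [M < 1], all entries vanish, and so do all values since [m >= 1]. Injectivity leaves at most
   one set in [G], whereas [G] holds 99 percent of at least [n >= 2] small sets. *)
have M1 : 1 <= M.
  rewrite leNgt; apply/negP => M1.
  have a0 := bounded_seq_lt1 aM M1.
  have e0 A : elem_sym m a A = 0.
    apply/ffunP => j; rewrite elem_sym_coord [RHS]ffunE big1// => B /andP[_ /eqP Bm].
    have [i iB] : exists i, i \in B by apply/card_gt0P; rewrite Bm.
    by rewrite (bigD1 i)//= a0 ffunE mul0r.
  have G1 : (#|G| <= 1)%N.
    by apply/card_le1P => A AG B; rewrite inE; apply/idP/eqP => [BG|->//]; apply: injG => //; rewrite !e0.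
  have := card_small_sets_ge_n hn2; rewrite -(ler_nat R) => Nn.
  have : (2%:R : R) <= n%:R by rewrite ler_nat.
  have : (#|G|%:R : R) <= 1%:R by rewrite ler_nat.
  by move: GN Nn; lra.
by rewrite addr0 mul1r; exact: (spread_family_bound k0 m0 l0 npos GP aM M1 injG K500 hn3).
Qed.
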